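(* Let $c>0$, $m>0$, $\alpha\in\{0,\pi/2\}$, let $D_0$ be the half-line Dirac operator with boundary condition $\psi_1(0)\cos\alpha-\psi_2(0)\sin\alpha=0$ and let $V$ be a (not necessarily Hermitian) potential, both as described in the context. Assume that $v=\|V\|_1/c<1/\sqrt2$. Then every eigenvalue $z\in\mathbb{C}\setminus\sigma(D_0)$ of $D_0+V$, written as $z=mc^2\frac{\zeta^2+1}{\zeta^2-1}$ with $\zeta=\zeta(z)=|\zeta|e^{\mathrm{i}t}$, $-\pi<t<0$, satisfies $$\left(\bigl(|\zeta|+|\zeta|^{-1}\bigr)\,G_{\mp}\!\left(\frac{|\zeta|-|\zeta|^{-1}}{|\zeta|+|\zeta|^{-1}},\,\cot(t)\right)\right)^{-1}\le\frac{1}{2c}\int_0^\infty\|V(x)\|\,dx,$$ with $G_-$ if $\alpha=0$ and $G_+$ if $\alpha=\pi/2$.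
   Context: $\mathbb{R}_+=(0,\infty)$. For $c>0$, $m>0$ and $\alpha\in\{0,\pi/2\}$, $D_0$ is the self-adjoint operator in $L^2(\mathbb{R}_+,\mathbb{C}^2)$ acting as $$D_0=\begin{pmatrix} mc^2 & -c\,\frac{d}{dx}\\ c\,\frac{d}{dx} & -mc^2\end{pmatrix}$$ on the domain of all $\psi=(\psi_1,\psi_2)^t\in H^1(\mathbb{R}_+,\mathbb{C}^2)$ with $\psi_1(0)\cos\alpha-\psi_2(0)\sin\alpha=0$. Its spectrum is $\sigma(D_0)=(-\infty,-mc^2]\cup[mc^2,\infty)$. The potential $V:[0,\infty)\to\mathrm{Mat}(2,\mathbb{C})$ is a complex $2\times2$-matrix-valued function, smooth on $[0,\infty)$ and with compact support in $[0,\infty)$; $V$ acts as a multiplication operator and $D_0+V$ is the operator sum, with the same domain as $D_0$. We write $\|V\|_1:=\int_0^\infty\|V(x)\|\,dx$, where $\|V(x)\|$ is the operator norm on $\mathbb{C}^2$. For $z\in\mathbb{C}\setminus\sigma(D_0)$ define $\kappa(z)$ by $c\,\kappa(z):=\sqrt{z^2-(mc^2)^2}$, with the branch of the square root chosen such that $\operatorname{Im}\kappa(z)>0$, and $$\zeta(z):=\frac{z+mc^2}{c\,\kappa(z)}.$$ Then $\operatorname{Im}\zeta(z)<0$ and $z=mc^2\frac{\zeta(z)^2+1}{\zeta(z)^2-1}$. For $a,b\in\mathbb{R}$ define $$G_{\mp}(a,b):=\sqrt{\sup_{y\ge0}\left[\left(1+e^{-2y}\right)\mp2a\,e^{-y}\cos(aby)\right]}.$$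 *)

(* Defs.v *)
From HB Require Import structures.
From mathcomp Require Import all_boot all_order all_algebra.
From mathcomp Require Import complex.
From mathcomp Require Import all_classical all_reals all_analysis.

Set Implicit Arguments.
Unset Strict Implicit.
Unset Printing Implicit Defensive.

Import Order.TTheory GRing.Theory Num.Theory.
Import numFieldNormedType.Exports.

Local Open Scope classical_set_scope.
Local Open Scope complex_scope.
Local Open Scope ring_scope.

Section Defs.
Variable R : realType.

Local Notation C := (R[i]).
Local Notation C2 := ('cV[R[i]]_2).
Local Notation mu := (@lebesgue_measure R).

Definition cabs (z : C) : R := Normc.normc z.

Definition vnorm (v : C2) : R := Num.sqrt (\sum_i cabs (v i 0) ^+ 2).

Definition opnorm (A : 'M[C]_2) : R :=
  sup [set vnorm (A *m v) | v in [set v : C2 | vnorm v = 1]].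

(** ** The space L^2(R_+, C^2)

    Elements are represented by functions R -> C^2; only their values on
    R_+ matter, and equality in L^2 is [eqL2]. *)

Definition Rplus : set R := `]0, +oo[.

Definition eqL2 (f g : R -> C2) : Prop :=
  {ae mu, forall x, Rplus x -> f x = g x}.

Definition inL2 (f : R -> C2) : Prop :=
  [/\ forall i, measurable_fun Rplus (fun x => complex.Re (f x i 0)),
      forall i, measurable_fun Rplus (fun x => complex.Im (f x i 0)) &
      (\int[mu]_(x in Rplus) ((vnorm (f x)) ^+ 2)%:E < +oo)%E].

Definition normL2 (f : R -> C2) : R :=
  Num.sqrt (Rintegral mu Rplus (fun x => vnorm (f x) ^+ 2)).

Definition vintegral (D : set R) (f : R -> C2) : C2 :=
  \col_i (Rintegral mu D (fun x => complex.Re (f x i 0))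
          +i* Rintegral mu D (fun x => complex.Im (f x i 0))).

(** [H1 psi g]: psi is (the continuous representative on [0, oo) of) an element
    of H^1(R_+, C^2), with derivative g.  Elements of H^1 are the absolutely
    continuous functions that are square-integrable together with their
    derivative; [psi 0] is then the boundary value. *)
Definition H1 (psi g : R -> C2) : Prop :=
  [/\ inL2 psi, inL2 g &
      forall x, 0 <= x -> psi x = psi 0 + vintegral `[0, x] g].

(** ** Operators in L^2(R_+, C^2)

    An unbounded operator T is given by its graph: [T psi f] means that psi is
    in the domain of T and T psi = f. *)

Definition operator := (R -> C2) -> (R -> C2) -> Prop.

Definition eigenvalue_of (T : operator) (z : C) : Prop :=
  exists psi f, [/\ T psi f, ~ eqL2 psi (fun=> 0) &
                    eqL2 f (fun x => z *: psi x)].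

(** T - z maps the domain of T onto L^2, and has a bounded inverse; the
    estimate includes injectivity. *)
Definition resolvent_set (T : operator) : set C :=
  [set z | (forall h, inL2 h -> exists psi f,
              T psi f /\ eqL2 (fun x => f x - z *: psi x) h) /\
           (exists K : R, forall psi f, T psi f ->
              normL2 psi <= K * normL2 (fun x => f x - z *: psi x))].

Definition spectrum (T : operator) : set C := ~` resolvent_set T.

Definition add_potential (T : operator) (V : R -> 'M[C]_2) : operator :=
  fun psi f => exists f0, T psi f0 /\
    forall x, Rplus x -> f x = f0 x + V x *m psi x.

Definition dirac_expr (m c : R) (psi g : C2) : C2 :=
  \col_i (if i == 0
          then (m * c ^+ 2)%:C * psi 0 0 - c%:C * g 1 0
          else c%:C * g 0 0 - (m * c ^+ 2)%:C * psi 1 0).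

Definition D0 (m c alpha : R) : operator :=
  fun psi f => exists g,
    [/\ H1 psi g,
        (cos alpha)%:C * psi 0 0 0 - (sin alpha)%:C * psi 0 1 0 = 0 &
        forall x, Rplus x -> f x = dirac_expr m c (psi x) (g x)].

(** ** Potentials *)

(** Smoothness up to the boundary: F n is the n-th derivative of f on
    [0, oo), one-sided at 0. *)
Definition smooth_halfline (f : R -> R) : Prop :=
  exists F : nat -> R -> R,
    (forall x, 0 <= x -> F 0 x = f x) /\
    (forall n x, 0 <= x ->
      (F n y - F n x) / (y - x) @[y --> within `[0, +oo[ x^'] --> F n.+1 x).

Definition is_potential (V : R -> 'M[C]_2) : Prop :=
  [/\ forall i j, smooth_halfline (fun x => complex.Re (V x i j)),
      forall i j, smooth_halfline (fun x => complex.Im (V x i j)) &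
      exists M : R, forall x, 0 <= x -> M < x -> V x = 0].

Definition norm1 (V : R -> 'M[C]_2) : R :=
  Rintegral mu `[0, +oo[ (fun x => opnorm (V x)).

(** ** Spectral parameters *)

(** The square root with positive imaginary part, for w not in [0, oo). *)
Definition sqrt_up (w : C) : C :=
  if 0 < complex.Im (sqrtc w) then sqrtc w else - sqrtc w.

Definition kappa (m c : R) (z : C) : C :=
  sqrt_up (z ^+ 2 - (m * c ^+ 2)%:C ^+ 2) / c%:C.

Definition zeta (m c : R) (z : C) : C :=
  (z + (m * c ^+ 2)%:C) / (c%:C * kappa m c z).

Definition Gminus (a b : R) : R :=
  Num.sqrt (sup [set (1 + expR (- (2 * y))) - 2 * a * expR (- y) * cos (a * b * y)
                | y in `[0, +oo[]).

Definition Gplus (a b : R) : R :=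
  Num.sqrt (sup [set (1 + expR (- (2 * y))) + 2 * a * expR (- y) * cos (a * b * y)
                | y in `[0, +oo[]).

Definition cot (t : R) : R := cos t / sin t.

End Defs.

(* Main.v *)
Require Import Defs.
From HB Require Import structures.
From mathcomp Require Import all_boot all_order all_algebra.
From mathcomp Require Import complex ring lra.
From mathcomp Require Import all_classical all_reals all_analysis measurable_realfun.

Import Order.TTheory GRing.Theory Num.Theory.
Import numFieldNormedType.Exports.
Local Open Scope classical_set_scope.
Local Open Scope complex_scope.
Local Open Scope ring_scope.

Set Implicit Arguments.
Unset Strict Implicit.
Unset Printing Implicit Defensive.

(** Idea of the proof.  With [mu = m c^2], [A = (z + mu) / c = kappa zeta] and
    [B = (z - mu) / c = kappa / zeta], the eigenvalue equation for [psi] is the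
    first-order system [psi1' = A psi2 + h1], [psi2' = - B psi1 + h2] whose
    source [h] has norm at most [opnorm V * |psi| / c].  Let [u] be the
    solution without source that satisfies the boundary condition at [0], and
    [e = exp (i kappa x) (zeta, i)] the one that decays at infinity.  The
    Wronskians [P] of [psi] with [u] and [Q] of [psi] with [e] have derivatives
    in which only [h] appears; [P] vanishes at [0] by the boundary condition,
    and [Q] vanishes beyond the support of [V] because it is constant there and
    dominated by the square-integrable function [|psi|]
    ([wronskian_tail0]).  Since [psi = (Q u - P e) / w], where [w] is the
    Wronskian of [u] and [e], and since [|e|] decreases, this gives
    ([green_estimate])
      [w |psi x| <= sup (|u| |e|) * int opnorm V / c * max |psi|];
    at a maximum of [|psi|] the function drops out ([eigenvalue_bound]) and
    what remains is the claim, because [sup (|u| |e|) / w] is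
    [(|zeta| + |zeta|^-1) / 2] times the value of [Gminus] or [Gplus]
    ([green_kernel_dirichlet], [green_kernel_neumann]): [|u y|^2 |e y|^2] is
    computed explicitly, and the phase [2 Re kappa y] in it is, up to sign,
    [a cot t] times [2 Im kappa y], since [kappa] is a positive multiple of
    [(zeta - zeta^-1)^-1] ([Re_kappa]).

    That [Im kappa > 0] needs [z^2 - mu^2] to avoid the nonnegative reals, so
    the real points with [z^2 >= mu^2] have to be found in the spectrum
    ([spectrum_real]).  There [D0 - z] is not onto: if a source supported in
    [[0, 1]] had a preimage in [L^2], the preimage would vanish at [1], so its
    Wronskian with [u] would vanish at both ends of [[0, 1]], and a suitable
    source makes this Wronskian strictly increasing.

    Integrals enter only through square-integrability, the passage from [H^1]
    to classical solutions ([dirac_regular]) and the primitive of [opnorm V]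
    ([potential_primitive]); the estimates themselves rest on the mean value
    inequality [cder_growth]. *)

(** * Modulus of complex numbers and of pairs of them *)

Section ComplexModulus.
Variable R : realType.
Implicit Types z w a b : R[i].

Lemma cabsE z : cabs z = Num.sqrt (complex.Re z ^+ 2 + complex.Im z ^+ 2).
Proof. by case: z. Qed.

Lemma cabs_ge0 z : 0 <= cabs z.
Proof. by rewrite cabsE sqrtr_ge0. Qed.

Lemma cabs_sqr z : cabs z ^+ 2 = complex.Re z ^+ 2 + complex.Im z ^+ 2.
Proof. by rewrite cabsE sqr_sqrtr// addr_ge0 ?sqr_ge0. Qed.

Lemma cabsM z w : cabs (z * w) = cabs z * cabs w.
Proof. exact: Normc.normcM. Qed.

Lemma cabsV z : cabs z^-1 = (cabs z)^-1.
Proof. exact: Normc.normcV. Qed.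

Lemma cabs0 : cabs (0 : R[i]) = 0.
Proof. exact: Normc.normc0. Qed.

Lemma cabs0_eq z : cabs z = 0 -> z = 0.
Proof. exact: Normc.eq0_normc. Qed.

Lemma cabs_gt0 z : z != 0 -> 0 < cabs z.
Proof.
move=> z0; rewrite lt_def cabs_ge0 andbT.
by apply: contra z0 => /eqP/cabs0_eq ->.
Qed.

Lemma cabsN z : cabs (- z) = cabs z.
Proof. exact: normcN. Qed.

Lemma cabsD z w : cabs (z + w) <= cabs z + cabs w.
Proof. exact: le_normcD. Qed.

Lemma cabsB z w : cabs (z - w) <= cabs z + cabs w.
Proof. by rewrite (le_trans (cabsD _ _))// cabsN. Qed.

Lemma cabs_real (x : R) : cabs x%:C = `|x|.
Proof. by rewrite cabsE /= expr0n addr0 sqrtr_sqr. Qed.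

Lemma cabs_conj z : cabs z^* = cabs z.
Proof. by case: z => x y; rewrite !cabsE /= sqrrN. Qed.

Lemma Re_le_cabs z : complex.Re z <= cabs z.
Proof.
by rewrite cabsE (le_trans (ler_norm _))// -sqrtr_sqr ler_wsqrtr// lerDl sqr_ge0.
Qed.

Lemma normRe_le_cabs z : `|complex.Re z| <= cabs z.
Proof. by rewrite cabsE -sqrtr_sqr ler_wsqrtr// lerDl sqr_ge0. Qed.

Lemma normIm_le_cabs z : `|complex.Im z| <= cabs z.
Proof. by rewrite cabsE -sqrtr_sqr ler_wsqrtr// lerDr sqr_ge0. Qed.

Lemma conj_mul_cabs z : z^* * z = (cabs z ^+ 2)%:C.
Proof.
by case: z => x y; rewrite cabs_sqr /=; simpc; congr (_ +i* _); ring.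
Qed.

Lemma cReM z w : complex.Re (z * w) =
  complex.Re z * complex.Re w - complex.Im z * complex.Im w.
Proof. by case: z w => [a b] [c d]. Qed.

Lemma cImM z w : complex.Im (z * w) =
  complex.Re z * complex.Im w + complex.Im z * complex.Re w.
Proof. by case: z w => [a b] [c d]. Qed.

Lemma cReD z w : complex.Re (z + w) = complex.Re z + complex.Re w.
Proof. by case: z w => [a b] [c d]. Qed.

Lemma cImD z w : complex.Im (z + w) = complex.Im z + complex.Im w.
Proof. by case: z w => [a b] [c d]. Qed.

Lemma cReN z : complex.Re (- z) = - complex.Re z.
Proof. by case: z. Qed.

Lemma cImN z : complex.Im (- z) = - complex.Im z.
Proof. by case: z. Qed.

Lemma cReC (x : R) : complex.Re x%:C = x.
Proof. by []. Qed.

Lemma cImC (x : R) : complex.Im x%:C = 0.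
Proof. by []. Qed.

Lemma complex_eq z w : complex.Re z = complex.Re w ->
  complex.Im z = complex.Im w -> z = w.
Proof. by case: z w => [a b] [c d] /= -> ->. Qed.

Definition pnorm a b : R := Num.sqrt (cabs a ^+ 2 + cabs b ^+ 2).

Lemma pnorm_ge0 a b : 0 <= pnorm a b.
Proof. exact: sqrtr_ge0. Qed.

Lemma pnorm_sqr a b : pnorm a b ^+ 2 = cabs a ^+ 2 + cabs b ^+ 2.
Proof. by rewrite sqr_sqrtr// addr_ge0 ?sqr_ge0. Qed.

Lemma cabs_le_pnorml a b : cabs a <= pnorm a b.
Proof.
by rewrite -(ger0_norm (cabs_ge0 a)) -sqrtr_sqr ler_wsqrtr// lerDl sqr_ge0.
Qed.

Lemma cabs_le_pnormr a b : cabs b <= pnorm a b.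
Proof.
by rewrite -(ger0_norm (cabs_ge0 b)) -sqrtr_sqr ler_wsqrtr// lerDr sqr_ge0.
Qed.

Lemma pnormM k a b : pnorm (k * a) (k * b) = cabs k * pnorm a b.
Proof.
rewrite /pnorm !cabsM !exprMn -mulrDr sqrtrM ?sqr_ge0// sqrtr_sqr.
by rewrite ger0_norm// cabs_ge0.
Qed.

Lemma pnormC a b : pnorm a b = pnorm b a.
Proof. by rewrite /pnorm addrC. Qed.

Lemma pnormNl a b : pnorm (- a) b = pnorm a b.
Proof. by rewrite /pnorm cabsN. Qed.

Lemma real_cauchy_schwarz (x y s t : R) : 0 <= x -> 0 <= y -> 0 <= s -> 0 <= t ->
  x * t + y * s <= Num.sqrt (x ^+ 2 + y ^+ 2) * Num.sqrt (s ^+ 2 + t ^+ 2).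
Proof.
move=> x0 y0 s0 t0.
rewrite -sqrtrM ?addr_ge0 ?sqr_ge0//.
rewrite -(ger0_norm (_ : 0 <= x * t + y * s)); last by rewrite addr_ge0// mulr_ge0.
rewrite -sqrtr_sqr ler_wsqrtr//.
have := sqr_ge0 (x * s - y * t); nra.
Qed.

Lemma cross_le a b c d : cabs (a * d - b * c) <= pnorm a b * pnorm c d.
Proof.
apply: le_trans (cabsB _ _) _; rewrite !cabsM.
by rewrite /pnorm real_cauchy_schwarz// cabs_ge0.
Qed.

Lemma pnormD a b c d : pnorm (a + c) (b + d) <= pnorm a b + pnorm c d.
Proof.
have h0 : 0 <= pnorm a b + pnorm c d by rewrite addr_ge0 ?pnorm_ge0.
rewrite -(ger0_norm h0) -sqrtr_sqr ler_wsqrtr//.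
have H1 := cabsD a c; have H2 := cabsD b d.
have CS := @real_cauchy_schwarz (cabs a) (cabs b) (cabs d) (cabs c)
  (cabs_ge0 _) (cabs_ge0 _) (cabs_ge0 _) (cabs_ge0 _).
rewrite -/(pnorm a b) -/(pnorm d c) (pnormC d) in CS.
have E1 := pnorm_sqr a b; have E2 := pnorm_sqr c d.
have K1 : cabs (a + c) ^+ 2 <= (cabs a + cabs c) ^+ 2.
  by rewrite ler_sqr ?nnegrE ?addr_ge0 ?cabs_ge0.
have K2 : cabs (b + d) ^+ 2 <= (cabs b + cabs d) ^+ 2.
  by rewrite ler_sqr ?nnegrE ?addr_ge0 ?cabs_ge0.
nra.
Qed.

Lemma pnorm_eq0 a b : pnorm a b = 0 -> a = 0 /\ b = 0.
Proof.
move=> h; split; apply/cabs0_eq/eqP; rewrite eq_le cabs_ge0 andbT -h.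
  exact: cabs_le_pnorml.
exact: cabs_le_pnormr.
Qed.

Lemma pnorm_gt0 a b : (a = 0 -> b = 0 -> False) -> 0 < pnorm a b.
Proof.
move=> h; rewrite lt_def pnorm_ge0 andbT; apply/eqP => /pnorm_eq0[].
exact: h.
Qed.

End ComplexModulus.

(** * Derivatives of complex-valued functions *)

Section ComplexDerivative.
Variable R : realType.
Implicit Types (f g : R -> R[i]) (x : R) (d k : R[i]).

(** Componentwise, so that the mean value theorem and the fundamental theorem
    of calculus for real functions apply to each part. *)
Definition cder f x d : Prop :=
  is_derive x (1 : R) (fun y => complex.Re (f y)) (complex.Re d) /\
  is_derive x (1 : R) (fun y => complex.Im (f y)) (complex.Im d).

Lemma cder_eq f x d d' : cder f x d -> d = d' -> cder f x d'.
Proof. by move=> h <-. Qed.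

Lemma cder_cst k x : cder (fun=> k) x 0.
Proof. by split; exact: is_derive_cst. Qed.

Lemma cderD f g x d e : cder f x d -> cder g x e ->
  cder (fun y => f y + g y) x (d + e).
Proof.
move=> [fR fI] [gR gI]; split.
  rewrite cReD; under [X in is_derive _ _ X _]eq_fun do rewrite cReD.
  exact: is_deriveD.
rewrite cImD; under [X in is_derive _ _ X _]eq_fun do rewrite cImD.
exact: is_deriveD.
Qed.

Lemma cderN f x d : cder f x d -> cder (fun y => - f y) x (- d).
Proof.
move=> [fR fI]; split.
  rewrite cReN; under [X in is_derive _ _ X _]eq_fun do rewrite cReN.
  exact: is_deriveN.
rewrite cImN; under [X in is_derive _ _ X _]eq_fun do rewrite cImN.
exact: is_deriveN.
Qed.

Lemma cderB f g x d e : cder f x d -> cder g x e ->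
  cder (fun y => f y - g y) x (d - e).
Proof. by move=> hf hg; apply: cderD => //; exact: cderN. Qed.

Lemma cderM f g x d e : cder f x d -> cder g x e ->
  cder (fun y => f y * g y) x (d * g x + f x * e).
Proof.
move=> [fR fI] [gR gI]; split.
  under [X in is_derive _ _ X _]eq_fun do rewrite cReM.
  apply: (is_derive_eq (is_deriveB (is_deriveM fR gR) (is_deriveM fI gI))).
  rewrite cReD !cReM /GRing.scale /=; ring.
under [X in is_derive _ _ X _]eq_fun do rewrite cImM.
apply: (is_derive_eq (is_deriveD (is_deriveM fR gI) (is_deriveM fI gR))).
rewrite cImD !cImM /GRing.scale /=; ring.
Qed.

Lemma cderZ k f x d : cder f x d -> cder (fun y => k * f y) x (k * d).
Proof.
move=> h; have := cderM (cder_cst k x) h.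
by rewrite mul0r add0r.
Qed.

Lemma cder_real (f : R -> R) x (d : R) : is_derive x (1:R) f d ->
  cder (fun y => (f y)%:C) x d%:C.
Proof. by move=> h; split => //=; exact: is_derive_cst. Qed.

Definition cexp (z : R[i]) : R[i] :=
  (expR (complex.Re z))%:C * (cos (complex.Im z) +i* sin (complex.Im z)).

Lemma cexpD z w : cexp (z + w) = cexp z * cexp w.
Proof.
rewrite /cexp cReD cImD expRD cosD sinD.
apply: complex_eq; rewrite !(cReM, cImM) /=; ring.
Qed.

Lemma cexp0 : cexp 0 = 1.
Proof. by rewrite /cexp /= expR0 cos0 sin0 mul1r. Qed.

Lemma cexpN z : cexp z * cexp (- z) = 1.
Proof. by rewrite -cexpD subrr cexp0. Qed.

Lemma cabs_cexp z : cabs (cexp z) = expR (complex.Re z).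
Proof.
rewrite /cexp cabsM cabs_real ger0_norm ?expR_ge0// cabsE /=.
by rewrite cos2Dsin2 sqrtr1 mulr1.
Qed.

Lemma cder_cexp k x : cder (fun y => cexp (k * y%:C)) x (k * cexp (k * x%:C)).
Proof.
case: k => p q.
have hl (s : R) : is_derive x 1 (fun y : R => s * y) s.
  apply: (is_derive_eq (is_deriveM (is_derive_cst s x 1) (is_derive_id x 1))).
  by rewrite /GRing.scale /= mulr1 mulr0 addr0.
have he : is_derive x 1 (fun y : R => expR (p * y)) (expR (p * x) * p).
  exact: is_derive1_comp (is_derive_expR _) (hl p).
have hc : is_derive x 1 (fun y : R => cos (q * y)) (- sin (q * x) * q).
  exact: is_derive1_comp (is_derive_cos _) (hl q).
have hs : is_derive x 1 (fun y : R => sin (q * y)) (cos (q * x) * q).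
  exact: is_derive1_comp (is_derive_sin _) (hl q).
have E y : cexp ((p +i* q) * y%:C) =
    (expR (p * y))%:C * (cos (q * y) +i* sin (q * y)).
  by rewrite /cexp /= !mulr0 subr0 add0r.
rewrite E; under [X in cder X _ _]eq_fun do rewrite E.
have hcs : cder (fun y : R => cos (q * y) +i* sin (q * y)) x
    ((- sin (q * x) * q) +i* (cos (q * x) * q)) by split.
apply: (cder_eq (cderM (cder_real he) hcs)).
apply: complex_eq; rewrite !(cReD, cImD, cReM, cImM) /=; ring.
Qed.

Lemma cder_affine (a b : R[i]) (x : R) : cder (fun y => a + b * y%:C) x b.
Proof.
apply: (cder_eq (cderD (cder_cst a x) (cderZ b (cder_real (is_derive_id x 1))))).
by rewrite add0r mulr1.
Qed.

End ComplexDerivative.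

(** * Growth estimates and Wronskians *)

Section GrowthAndWronskian.
Variable R : realType.
Implicit Types (f g h p u e P : R -> R[i]) (N n : R -> R) (A B : R[i]).

Lemma is_derive_within_continuous (f df : R -> R) (a b : R) :
  (forall x, a <= x <= b -> is_derive x (1 : R) f (df x)) ->
  {within `[a, b]%classic, continuous f}.
Proof.
move=> h; apply: derivable_within_continuous => x.
by rewrite in_itv /= => /h [].
Qed.

(** The real mean value theorem applies once the increment of [P] has been
    rotated onto the positive axis. *)
Lemma cder_growth P dP N n (a b : R) : a <= b ->
  (forall x, a <= x <= b -> cder P x (dP x)) ->
  (forall x, a <= x <= b -> is_derive x (1 : R) N (n x)) ->
  (forall x, a <= x <= b -> cabs (dP x) <= n x) ->
  cabs (P b - P a) <= N b - N a.
Proof.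
move=> ab hP hN hle.
(* If [D = 0] then [t = 0], as [0 / 0 = 0]; both facts below still hold. *)
set D := P b - P a; pose t := D^* / (cabs D)%:C.
have t1 : cabs t <= 1.
  rewrite /t cabsM cabsV cabs_conj cabs_real ger0_norm ?cabs_ge0//.
  have [->|D0] := eqVneq (cabs D) 0; first by rewrite mul0r.
  by rewrite divff.
have tD : complex.Re (t * D) = cabs D.
  have [D0|D0] := eqVneq (cabs D) 0.
    by rewrite D0 (cabs0_eq D0) mulr0.
  rewrite /t mulrAC conj_mul_cabs -fmorphV -rmorphM /=.
  by rewrite expr2 mulfK.
pose F x := complex.Re (t * P x) - N x.
have hF x : a <= x <= b -> is_derive x (1 : R) F (complex.Re (t * dP x) - n x).
  by move=> hx; apply: is_deriveB (hN x hx); exact: (cderZ t (hP x hx)).1.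
have [||c cab hc] := @MVT_segment R F
  (fun x => complex.Re (t * dP x) - n x) a b ab.
- move=> x; rewrite in_itv /= => /andP[ax xb]; apply: hF.
  by rewrite !ltW.
- exact: is_derive_within_continuous hF.
have dle : complex.Re (t * dP c) - n c <= 0.
  rewrite subr_le0; rewrite in_itv /= in cab.
  apply: le_trans (hle c cab); apply: le_trans (Re_le_cabs _) _.
  by rewrite cabsM ler_piMl ?cabs_ge0.
have : F b - F a <= 0 by rewrite hc mulr_le0_ge0// subr_ge0.
rewrite /F -tD /D mulrBr cReD cReN.
lra.
Qed.

Lemma cder_constant P (a b : R) : a <= b ->
  (forall x, a <= x <= b -> cder P x 0) -> P b = P a.
Proof.
move=> ab hP; apply/eqP; rewrite -subr_eq0; apply/eqP/cabs0_eq/eqP.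
rewrite eq_le cabs_ge0 andbT.
rewrite -[leRHS](subrr (0 : R)).
apply: (cder_growth (P := P) (dP := fun=> 0) (N := fun=> 0) (n := fun=> 0)) => // x _.
by rewrite cabs0.
Qed.

(** The stationary Dirac equation with a source, solved for the derivatives;
    at energy [z] one has [A = (z + m c^2) / c] and [B = (z - m c^2) / c]. *)
Definition dirac_ode A B h1 h2 f1 f2 (x : R) :=
  cder f1 x (A * f2 x + h1 x) /\ cder f2 x (- (B * f1 x) + h2 x).

Lemma dirac_ode_hom A B f1 f2 x :
  cder f1 x (A * f2 x) -> cder f2 x (- (B * f1 x)) ->
  dirac_ode A B (fun=> 0) (fun=> 0) f1 f2 x.
Proof. by split; rewrite addr0. Qed.

Definition wronskian f1 f2 g1 g2 (x : R) := f1 x * g2 x - f2 x * g1 x.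

(** The system matrix has trace zero, so it drops out of the derivative of a
    Wronskian; only the source remains. *)
Lemma cder_wronskian A B h1 h2 f1 f2 g1 g2 x :
  dirac_ode A B h1 h2 f1 f2 x ->
  dirac_ode A B (fun=> 0) (fun=> 0) g1 g2 x ->
  cder (wronskian f1 f2 g1 g2) x (h1 x * g2 x - h2 x * g1 x).
Proof.
move=> [f1d f2d] [g1d g2d].
apply: (cder_eq (cderB (cderM f1d g2d) (cderM f2d g1d))); ring.
Qed.

(** The estimate by the Green kernel: [u] and [e] solve the homogeneous
    equation and are matched to the boundary condition at [0], resp. at [b],
    so the solution is [(Q u - P e) / w] with [P], [Q] its Wronskians with
    [u], [e] and [w] that of [u] with [e].  The hypothesis on [S] bounds
    the kernel, which is [u y (x) e x / w] for [y <= x]. *)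
Lemma green_estimate A B h1 h2 p1 p2 u1 u2 e1 e2 N n (b S x : R) :
  (forall y : R, 0 <= y -> dirac_ode A B h1 h2 p1 p2 y) ->
  (forall y : R, 0 <= y -> dirac_ode A B (fun=> 0) (fun=> 0) u1 u2 y) ->
  (forall y : R, 0 <= y -> dirac_ode A B (fun=> 0) (fun=> 0) e1 e2 y) ->
  (forall y : R, 0 <= y -> is_derive y (1 : R) N (n y)) ->
  (forall y : R, 0 <= y <= b -> pnorm (h1 y) (h2 y) <= n y) ->
  (forall y t : R, 0 <= y -> y <= t ->
     pnorm (u1 y) (u2 y) * pnorm (e1 t) (e2 t) <= S) ->
  wronskian p1 p2 u1 u2 0 = 0 -> wronskian p1 p2 e1 e2 b = 0 ->
  0 <= x <= b ->
  cabs (wronskian u1 u2 e1 e2 0) * pnorm (p1 x) (p2 x) <= S * (N b - N 0).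
Proof.
move=> hp hu he hN hn hS P0 Qb /andP[x0 xb].
set w := wronskian u1 u2 e1 e2 0.
pose P := wronskian p1 p2 u1 u2; pose Q := wronskian p1 p2 e1 e2.
have wx : wronskian u1 u2 e1 e2 x = w.
  apply: cder_constant => // y /andP[y0 _].
  by apply: (cder_eq (cder_wronskian (hu y y0) (he y y0))); ring.
have hSN (y : R) : 0 <= y -> is_derive y (1 : R) (fun s => S * N s) (S * n y).
  move=> y0; apply: (is_derive_eq
    (is_deriveM (is_derive_cst S y 1) (hN y y0))).
  by rewrite /GRing.scale /= mulr0 addr0.
have hP : cabs (P x) * pnorm (e1 x) (e2 x) <= S * N x - S * N 0.
  rewrite -[X in _ * X]ger0_norm ?pnorm_ge0// -cabs_real -cabsM mulrC.
  set k := (pnorm _ _)%:C.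
  have -> : k * P x = k * P x - k * P 0 by rewrite /P P0 mulr0 subr0.
  apply: (cder_growth (P := fun y => k * P y)
    (dP := fun y => k * (h1 y * u2 y - h2 y * u1 y))
    (N := fun s => S * N s) (n := fun s => S * n s)) => //.
  - by move=> y /andP[y0 _]; apply/cderZ/cder_wronskian; [exact: hp|exact: hu].
  - by move=> y /andP[y0 _]; exact: hSN.
  - move=> y /andP[y0 yx]; rewrite cabsM /k cabs_real ger0_norm ?pnorm_ge0//.
    have h := cross_le (h1 y) (h2 y) (u1 y) (u2 y).
    apply: (le_trans (ler_wpM2l (pnorm_ge0 _ _) h)).
    rewrite mulrCA mulrC ler_pM ?mulr_ge0 ?pnorm_ge0//.
      by rewrite mulrC; exact: hS.
    by rewrite hn// y0 (le_trans yx).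
have hQ : cabs (Q x) * pnorm (u1 x) (u2 x) <= S * N b - S * N x.
  rewrite -[X in _ * X]ger0_norm ?pnorm_ge0// -cabs_real -cabsM mulrC.
  set k := (pnorm _ _)%:C.
  rewrite -cabsN.
  have -> : - (k * Q x) = k * Q b - k * Q x by rewrite /Q Qb mulr0 sub0r.
  apply: (cder_growth (P := fun y => k * Q y)
    (dP := fun y => k * (h1 y * e2 y - h2 y * e1 y))
    (N := fun s => S * N s) (n := fun s => S * n s)) => //.
  - move=> y /andP[y0 _].
    by apply/cderZ/cder_wronskian; [exact/hp/(le_trans x0)|exact/he/(le_trans x0)].
  - by move=> y /andP[y0 _]; exact/hSN/(le_trans x0).
  - move=> y /andP[xy yb]; rewrite cabsM /k cabs_real ger0_norm ?pnorm_ge0//.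
    have h := cross_le (h1 y) (h2 y) (e1 y) (e2 y).
    apply: (le_trans (ler_wpM2l (pnorm_ge0 _ _) h)).
    rewrite mulrCA mulrC ler_pM ?mulr_ge0 ?pnorm_ge0//.
      exact: hS.
    by rewrite hn// yb (le_trans x0).
have E1 : w * p1 x = Q x * u1 x + - P x * e1 x.
  rewrite -wx /P /Q /wronskian; ring.
have E2 : w * p2 x = Q x * u2 x + - P x * e2 x.
  rewrite -wx /P /Q /wronskian; ring.
rewrite -pnormM E1 E2; apply: le_trans (pnormD _ _ _ _) _.
rewrite !pnormM cabsN.
lra.
Qed.

Lemma pnorm_attains_max f1 f2 d1 d2 (b : R) : 0 <= b ->
  (forall x, 0 <= x <= b -> cder f1 x (d1 x) /\ cder f2 x (d2 x)) ->
  exists2 x, 0 <= x <= b & forall y, 0 <= y <= b ->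
    pnorm (f1 y) (f2 y) <= pnorm (f1 x) (f2 x).
Proof.
move=> b0 hd.
have cf (g : R -> R) dg : (forall x, 0 <= x <= b -> is_derive x (1 : R) g (dg x)) ->
    forall x, 0 <= x <= b -> is_derive x (1 : R) (fun y => g y ^+ 2)
     (g x * dg x + g x * dg x).
  by move=> h x /h hg; apply: (is_derive_eq (is_deriveM hg hg)).
pose F x := (complex.Re (f1 x) ^+ 2 + complex.Im (f1 x) ^+ 2) +
            (complex.Re (f2 x) ^+ 2 + complex.Im (f2 x) ^+ 2).
have [c] : exists2 c, c \in `[0, b] & forall t, t \in `[0, b] -> F t <= F c.
  apply: EVT_max => //; apply: is_derive_within_continuous => x hx.
  apply: is_deriveD; apply: is_deriveD.
  - by apply: (cf (fun y => complex.Re (f1 y)) (fun y => complex.Re (d1 y))) hx => y /hd[[]].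
  - by apply: (cf (fun y => complex.Im (f1 y)) (fun y => complex.Im (d1 y))) hx => y /hd[[]].
  - by apply: (cf (fun y => complex.Re (f2 y)) (fun y => complex.Re (d2 y))) hx => y /hd[_ []].
  - by apply: (cf (fun y => complex.Im (f2 y)) (fun y => complex.Im (d2 y))) hx => y /hd[_ []].
rewrite in_itv /= => hc hm; exists c => // y hy.
by rewrite /pnorm ler_wsqrtr// !cabs_sqr; exact: hm.
Qed.

End GrowthAndWronskian.

(** * Explicit solutions of the homogeneous equation *)

Section ExplicitSolutions.
Variable R : realType.
Variables (k zt : R[i]).
Hypothesis zt0 : zt != 0.
Implicit Types (x : R).

Definition planewave x : R[i] := cexp ('i * k * x%:C).
Definition planewaveN x : R[i] := cexp (- ('i * k) * x%:C).
Definition ccos x : R[i] := 2^-1 * (planewave x + planewaveN x).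
Definition csin x : R[i] := - 'i * 2^-1 * (planewave x - planewaveN x).

Let ii : 'i * 'i = -1 :> R[i].
Proof. by rewrite -expr2 sqr_i. Qed.

Lemma planewaveK x : planewave x * planewaveN x = 1.
Proof. by rewrite /planewaveN mulNr cexpN. Qed.

Lemma planewave0 : planewave 0 = 1.
Proof. by rewrite /planewave mulr0 cexp0. Qed.

Lemma planewaveN0 : planewaveN 0 = 1.
Proof. by rewrite /planewaveN mulr0 cexp0. Qed.

Lemma ccos0 : ccos 0 = 1.
Proof. by rewrite /ccos planewave0 planewaveN0; field. Qed.

Lemma csin0 : csin 0 = 0.
Proof. by rewrite /csin planewave0 planewaveN0 subrr mulr0. Qed.

Lemma cder_ccos x : cder ccos x (- (k * csin x)).
Proof.
apply: (cder_eq (cderZ _ (cderD (cder_cexp _ x) (cder_cexp _ x)))).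
rewrite -/(planewave x) -/(planewaveN x) /csin; ring.
Qed.

Lemma cder_csin x : cder csin x (k * ccos x).
Proof.
apply: (cder_eq (cderZ _ (cderB (cder_cexp _ x) (cder_cexp _ x)))).
rewrite -/(planewave x) -/(planewaveN x) /ccos.
transitivity (- ('i * 'i) * (k * (2^-1 * (planewave x + planewaveN x)))).
  by ring.
by rewrite ii opprK mul1r.
Qed.

Lemma ccos2_csin2 x : ccos x * ccos x + csin x * csin x = 1.
Proof.
rewrite /ccos /csin.
set E := planewave x; set F := planewaveN x.
have EF : E * F = 1 by exact: planewaveK.
transitivity (2^-1 * 2^-1 *
    ((E + F) * (E + F) + ('i * 'i) * ((E - F) * (E - F)))); first by ring.
by rewrite ii -[RHS]EF; field.
Qed.

(** The solution with initial value [(s, t)].  The coefficients of the system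
    are written [k * zt] and [k / zt]: then [k ^ 2] is their product, and the
    plane waves have momentum [k] and polarization [(zt, i)]. *)
Definition ode_sol1 (s t : R[i]) x := s * ccos x + t * zt * csin x.
Definition ode_sol2 (s t : R[i]) x := t * ccos x - s * zt^-1 * csin x.

Lemma ode_sol_dirac s t x : dirac_ode (k * zt) (k / zt) (fun=> 0) (fun=> 0)
  (ode_sol1 s t) (ode_sol2 s t) x.
Proof.
apply: dirac_ode_hom.
  apply: (cder_eq (cderD (cderZ s (cder_ccos x)) (cderZ (t * zt) (cder_csin x)))).
  by rewrite /ode_sol2; field.
apply: (cder_eq (cderB (cderZ t (cder_ccos x)) (cderZ (s * zt^-1) (cder_csin x)))).
by rewrite /ode_sol1; field.
Qed.

(** For [Im k > 0] this is the solution that decays at infinity. *)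
Definition jost1 x := zt * planewave x.
Definition jost2 x := 'i * planewave x.

Lemma jost_dirac x : dirac_ode (k * zt) (k / zt) (fun=> 0) (fun=> 0)
  jost1 jost2 x.
Proof.
apply: dirac_ode_hom.
  apply: (cder_eq (cderZ zt (cder_cexp _ x))).
  by rewrite /jost2 -/(planewave x); ring.
apply: (cder_eq (cderZ 'i (cder_cexp _ x))).
rewrite /jost1 -/(planewave x).
transitivity (('i * 'i) * k * planewave x); first by ring.
by rewrite ii; field.
Qed.

Lemma cabs_planewave x : cabs (planewave x) = expR (- (complex.Im k * x)).
Proof.
rewrite /planewave cabs_cexp; congr expR.
by rewrite !(cReM, cImM) /=; ring.
Qed.

Lemma pnorm_jost x : pnorm (jost1 x) (jost2 x) =
  expR (- (complex.Im k * x)) * Num.sqrt (cabs zt ^+ 2 + 1).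
Proof.
rewrite /jost1 /jost2 ![_ * planewave x]mulrC pnormM cabs_planewave.
congr (_ * _); rewrite /pnorm; congr (Num.sqrt (_ + _)).
by rewrite cabs_sqr /= expr0n add0r expr1n.
Qed.

Lemma cabs_cexp_shift (z : R[i]) (s : R) : s ^+ 2 = 1 ->
  cabs (cexp z + s%:C) ^+ 2 =
  expR (2 * complex.Re z) + 1 + 2 * s * expR (complex.Re z) * cos (complex.Im z).
Proof.
move=> s1; rewrite cabs_sqr /cexp !(cReD, cImD, cReM, cImM) /=.
have h := cos2Dsin2 (complex.Im z).
have -> : expR (2 * complex.Re z) = expR (complex.Re z) ^+ 2.
  by rewrite mulrDl mul1r expRD expr2.
rewrite !mul0r subr0 !addr0.
set X := expR _; set c := cos _ in h *; set d := sin _ in h *.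
transitivity (X ^+ 2 * (c ^+ 2 + d ^+ 2) + s ^+ 2 + 2 * s * X * c); first by ring.
by rewrite h s1; ring.
Qed.

(** Multiplying by the decaying plane wave turns [cos] and [sin] into
    [(exp (2 i k x) + 1) / 2] and [(exp (2 i k x) - 1) / 2] up to a phase. *)
Lemma cabs_ccos_planewave x :
  cabs (ccos x * planewave x) ^+ 2 = 4^-1 *
  (1 + expR (- (2 * (2 * complex.Im k * x))) +
   2 * expR (- (2 * complex.Im k * x)) * cos (2 * complex.Re k * x)).
Proof.
have -> : ccos x * planewave x = 2^-1%:C * (cexp (2 * ('i * k * x%:C)) + 1%:C).
  rewrite mulrDl mul1r cexpD -/(planewave x).
  transitivity (2^-1 * (planewave x * planewave x + planewave x * planewaveN x)).
    by rewrite /ccos; ring.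
  by rewrite planewaveK fmorphV rmorphD !rmorph1.
rewrite cabsM exprMn cabs_cexp_shift ?expr1n// cabs_real ger0_norm ?invr_ge0//.
rewrite !(cReD, cImD, cReM, cImM) /=.
rewrite (_ : 2^-1 ^+ 2 = 4^-1 :> R); last by field.
rewrite !(mul0r, mul1r, mulr0, mulr1, addr0, add0r, subr0, sub0r).
congr (_ * _).
rewrite [X in X + _]addrC; congr (1 + expR _ + 2 * expR _ * cos _); ring.
Qed.

Lemma cabs_csin_planewave x :
  cabs (csin x * planewave x) ^+ 2 = 4^-1 *
  (1 + expR (- (2 * (2 * complex.Im k * x))) -
   2 * expR (- (2 * complex.Im k * x)) * cos (2 * complex.Re k * x)).
Proof.
have -> : csin x * planewave x =
    - 'i * (2^-1%:C * (cexp (2 * ('i * k * x%:C)) + (-1)%:C)).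
  rewrite mulrDl mul1r cexpD -/(planewave x).
  transitivity (- 'i * (2^-1 *
      (planewave x * planewave x - planewave x * planewaveN x))).
    by rewrite /csin; ring.
  by rewrite planewaveK fmorphV rmorphD rmorphN !rmorph1.
rewrite cabsM cabsN (_ : cabs 'i = 1); last first.
  by rewrite cabsE /= expr0n add0r expr1n sqrtr1.
rewrite mul1r cabsM exprMn cabs_cexp_shift; last by rewrite sqrrN expr1n.
rewrite cabs_real ger0_norm ?invr_ge0//.
rewrite !(cReD, cImD, cReM, cImM) /=.
rewrite (_ : 2^-1 ^+ 2 = 4^-1 :> R); last by field.
rewrite !(mul0r, mul1r, mulr0, mulr1, addr0, add0r, subr0, sub0r).
congr (_ * _).
rewrite mulrN1 !mulNr [X in X - _]addrC.
congr (1 + expR _ - 2 * expR _ * cos _); ring.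
Qed.

End ExplicitSolutions.

(** * From integral identities to classical derivatives *)

Section RealAntiderivatives.
Variable R : realType.
Local Notation mu := (@lebesgue_measure R).
Implicit Types (f g G : R -> R) (x b e : R).

(** Functions on the closed half-line are extended to the left by their value
    at [0], so that later arguments meet no one-sided limits. *)
Lemma continuous_max0 f :
  (forall x, 0 <= x -> forall e, 0 < e ->
     \forall y \near x, 0 <= y -> `|f x - f y| <= e) ->
  continuous (fun x => f (Num.max x 0)).
Proof.
move=> h x; apply/cvgrPdist_le => e e0.
have cm : Num.max y 0 @[y --> x] --> Num.max x 0.
  apply: (@continuous_max R R^o id (fun=> 0) x); first exact: cvg_id.
  exact: cvg_cst.
have x0 : 0 <= Num.max x 0 by rewrite le_max lexx orbT.
have hn := cm _ (h _ x0 e e0).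
near=> y; have : 0 <= Num.max y 0 by rewrite le_max lexx orbT.
near: y; exact: hn.
Unshelve. all: by end_near. Qed.

Lemma continuous_integrable_itv G (a b : R) : continuous G ->
  mu.-integrable `[a, b] (EFin \o G).
Proof.
move=> cG; apply: continuous_compact_integrable; first exact: segment_compact.
exact: continuous_subspaceT.
Qed.

Lemma integral_halfline_support G b : 0 <= b -> continuous G ->
  (forall x, 0 <= x -> 0 <= G x) -> (forall x, b < x -> G x = 0) ->
  integral mu `[0, +oo[ (EFin \o G) = integral mu `[0, b] (EFin \o G).
Proof.
move=> b0 cG G0 Gb.
have -> : `[0, +oo[%classic = `[0, b] `|` `]b, +oo[ :> set R.
  by rewrite -itv_bndbnd_setU// bnd_simp.
rewrite ge0_integral_setU//=.
- rewrite [X in (_ + X)%E]integral0_eq ?adde0// => x.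
  by rewrite /= in_itv /= andbT => bx; rewrite Gb.
- apply/measurable_EFinP; apply: measurable_funTS.
  exact: continuous_measurable_fun.
- move=> x [|]; rewrite /= in_itv /= => /andP[x0 _]; rewrite lee_fin G0//.
  by rewrite ltW// (le_lt_trans b0).
- apply/disj_setPS => y [/=]; rewrite !in_itv /= andbT => /andP[_ yb].
  by rewrite ltNge yb.
Qed.

Lemma continuous_primitive f g : (forall x, 0 <= x ->
    mu.-integrable `[0, x] (EFin \o g)) ->
  (forall x, 0 <= x -> f x = f 0 + \int[mu]_(t in `[0, x]) g t) ->
  continuous (fun x => f (Num.max x 0)).
Proof.
move=> ig hf; apply: continuous_max0 => x x0 e e0.
have x10 : 0 <= x + 1 by lra.
have := parameterized_integral_continuous x10 (ig _ x10).
move=> /subspace_continuousP/(_ x).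
have xin : `[0, x + 1]%classic x by rewrite /= in_itv /= x0 /=; lra.
move=> /(_ xin)/cvgrPdist_le/(_ e e0); rewrite near_withinE => hn.
near=> y => y0.
rewrite (hf x x0) (hf y y0).
rewrite (_ : _ - _ = \int[mu]_(t in `[0, x]) g t - \int[mu]_(t in `[0, y]) g t);
  last by ring.
have : `[0, x + 1]%classic y.
  rewrite /= in_itv /= y0 /=.
  by apply/ltW; near: y; apply: lt_nbhsl; lra.
near: y; exact: hn.
Unshelve. all: by end_near. Qed.

(** A primitive of a function that agrees a.e. with a continuous one.  The
    integral is started at [-1], so that the derivative is two-sided at [0]
    too. *)
Lemma derivable_primitive f g G : continuous G ->
  (forall x, 0 <= x -> mu.-integrable `[0, x] (EFin \o g)) ->
  {ae mu, forall x, Rplus x -> g x = G x} ->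
  (forall x, 0 <= x -> f x = f 0 + \int[mu]_(t in `[0, x]) g t) ->
  exists F : R -> R, (forall x, 0 <= x -> F x = f x) /\
    (forall x, 0 <= x -> is_derive x (1 : R) F (G x)).
Proof.
move=> cG ig gG hf.
have iG a b := continuous_integrable_itv a b cG.
pose K x := \int[mu]_(t in `[-1, x]) G t.
exists (fun x => f 0 - K 0 + K x); split => x x0.
  rewrite (hf x x0) -addrA; congr (_ + _); rewrite addrC /K Rintegral_itvB//.
    rewrite Rintegral_itv_obnd_cbnd; last first.
      by apply: integrableS (iG 0 x) => //; exact: subset_itv_oc_cc.
    rewrite /Rintegral; congr fine; apply: ae_eq_integral => //.
    - by have /integrableP[] := iG 0 x.
    - by have /integrableP[] := ig x x0.
    - have : {ae mu, forall t, t <> 0}.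
        exists [set 0]; split => //; first by rewrite lebesgue_measure_set1.
        by move=> t /= /contrapT.
      move: gG; apply: filterS2.
        exact: (ae_filter_ringOfSetsType mu).
      move=> t h1 t0; rewrite /= in_itv /= => /andP[t1 _].
      rewrite h1// /Rplus /= in_itv /= andbT lt_def t1 andbT.
      by apply/eqP.
  - by rewrite bnd_simp; lra.
have [] := @continuous_FTC1_closed R G (-1) x (x + 1) _ (iG _ _) _ (cG x).
- by lra.
- by lra.
move=> dK K'.
have hK : is_derive x (1 : R) K (G x) 
  by apply: (DeriveDef dK); rewrite -derive1E K'.
apply: (is_derive_eq (is_deriveD (is_derive_cst (f 0 - K 0) x 1) hK)).
by rewrite add0r.
Qed.

Lemma continuous_diffquot f (d : R -> R) :
  (forall x, 0 <= x ->
     (f y - f x) / (y - x) @[y --> within `[0, +oo[ x^'] --> d x) ->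
  continuous (fun x => f (Num.max x 0)).
Proof.
move=> hq; apply: continuous_max0 => x x0 e e0.
have /cvgrPdist_le/(_ 1 ltr01) := hq x x0.
rewrite near_withinE /dnbhs near_withinE => hn.
have {}hn : \forall y \near x, y != x -> 0 <= y ->
    `|d x - (f y - f x) / (y - x)| <= 1.
  apply: filterS hn => y h yx y0.
  by apply: h; rewrite //= in_itv /= y0.
pose D := `|d x| + 1.
have D0 : 0 < D by rewrite /D ltr_wpDl.
have hd : \forall y \near x, `|x - y| <= e / D.
  have eD : 0 < e / D by rewrite divr_gt0.
  by have := @near_ball _ R x _ eD; apply: filterS => y /ltW.
near=> y => y0.
have [->|yx] := eqVneq y x; first by rewrite subrr normr0 ltW.
have q1 : `|(f y - f x) / (y - x)| <= D.
  rewrite /D.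
  have h : `|d x - (f y - f x) / (y - x)| <= 1.
    by move: y0; move: yx; near: y; exact: hn.
  set q := (X in `|X|) in h *.
  rewrite (_ : (f y - f x) / (y - x) = d x - q); last by rewrite /q; ring.
  by apply: le_trans (ler_normB _ _) _; rewrite lerD2l.
have q2 : `|x - y| <= e / D by near: y; exact: hd.
rewrite distrC (_ : f y - f x = (f y - f x) / (y - x) * (y - x)); last first.
  by rewrite divfK// subr_eq0.
rewrite normrM [X in _ * X]distrC.
have -> : e = D * (e / D) by rewrite mulrCA divff ?mulr1// gt_eqF.
by apply: ler_pM.
Unshelve. all: by end_near. Qed.

End RealAntiderivatives.

(** * Square-integrable functions and regularity of solutions *)

Section ComplexContinuity.
Variable R : realType.
Implicit Types (f g : R -> R[i]).

Definition ccontinuous f : Prop :=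
  continuous (fun x => complex.Re (f x)) /\
  continuous (fun x => complex.Im (f x)).

Lemma ccontinuous_cst (k : R[i]) : ccontinuous (fun=> k).
Proof. by split => x; exact: cst_continuous. Qed.

Lemma ccontinuousD f g : ccontinuous f -> ccontinuous g ->
  ccontinuous (fun x => f x + g x).
Proof.
move=> [f1 f2] [g1 g2]; split => x.
  under eq_fun do rewrite cReD.
  exact: (continuousD (f1 x) (g1 x)).
under eq_fun do rewrite cImD.
exact: (continuousD (f2 x) (g2 x)).
Qed.

Lemma ccontinuousN f : ccontinuous f -> ccontinuous (fun x => - f x).
Proof.
move=> [f1 f2]; split => x.
  under eq_fun do rewrite cReN.
  exact: (continuousN (f1 x)).
under eq_fun do rewrite cImN.
exact: (continuousN (f2 x)).
Qed.

Lemma ccontinuousM f g : ccontinuous f -> ccontinuous g ->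
  ccontinuous (fun x => f x * g x).
Proof.
move=> [f1 f2] [g1 g2]; split => x.
  under eq_fun do rewrite cReM.
  exact: (continuousB (continuousM (f1 x) (g1 x)) (continuousM (f2 x) (g2 x))).
under eq_fun do rewrite cImM.
exact: (continuousD (continuousM (f1 x) (g2 x)) (continuousM (f2 x) (g1 x))).
Qed.

Lemma ccontinuous_eq f g : f =1 g -> ccontinuous f -> ccontinuous g.
Proof. by move=> /funext ->. Qed.

Lemma cder_ccontinuous f d : (forall x, cder f x (d x)) -> ccontinuous f.
Proof.
by move=> h; split => x; apply: differentiable_continuous;
  apply/derivable1_diffP; have [[] + _ [] + _] := h x.
Qed.

Lemma ccontinuous_conj f : ccontinuous f -> ccontinuous (fun x => (f x)^*).
Proof.
move=> [f1 f2]; split => x.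
  rewrite (_ : (fun y => _) = (fun y => complex.Re (f y))); first exact: f1.
  by apply/funext => y; case: (f y).
rewrite (_ : (fun y => _) = (fun y => - complex.Im (f y))).
  exact: (continuousN (f2 x)).
by apply/funext => y; case: (f y).
Qed.

Lemma ccontinuous_real (f : R -> R) : continuous f ->
  ccontinuous (fun x => (f x)%:C).
Proof. by move=> cf; split => // x; exact: cst_continuous. Qed.

Lemma continuous_cabs_sqr f : ccontinuous f ->
  continuous (fun x => cabs (f x) ^+ 2).
Proof.
move=> [f1 f2] x; under eq_fun do rewrite cabs_sqr.
exact: (continuousD (continuousM (f1 x) (f1 x)) (continuousM (f2 x) (f2 x))).
Qed.

End ComplexContinuity.

Section SquareIntegrable.
Variable R : realType.
Local Notation mu := (@lebesgue_measure R).
Implicit Types (psi g h : R -> 'cV[R[i]]_2).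

Lemma vnormE (v : 'cV[R[i]]_2) : vnorm v = pnorm (v 0 0) (v 1 0).
Proof.
rewrite /vnorm /pnorm big_ord_recl big_ord1; congr (Num.sqrt (_ + cabs (v _ _) ^+ 2)).
exact/val_inj.
Qed.

Lemma inL2_measurable psi : inL2 psi ->
  measurable_fun (@Rplus R) (fun x => vnorm (psi x) ^+ 2).
Proof.
move=> [mR mI _].
under eq_fun do rewrite vnormE pnorm_sqr !cabs_sqr.
by apply: measurable_funD; apply: measurable_funD; apply: measurable_funX.
Qed.

(** By [|f| <= 1 + |f|^2], square-integrable functions are locally integrable;
    this holds up to the end point [0], a null set. *)
Lemma inL2_integrable (psi : R -> 'cV[R[i]]_2) (f : R -> R) (b : R) :
  inL2 psi -> measurable_fun (@Rplus R) f ->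
  (forall x, `|f x| <= vnorm (psi x)) -> mu.-integrable `[0, b] (EFin \o f).
Proof.
move=> hpsi mf hf.
have sub : `]0, b]%classic `<=` @Rplus R.
  by move=> x /=; rewrite /Rplus /= !in_itv /= andbT => /andP[].
have mfb : measurable_fun `]0, b]%classic f.
  by apply: measurable_funS mf => //; exact: measurable_itv.
suff : mu.-integrable `]0, b] (EFin \o f).
  move=> /integrableP[mf1 fin]; apply/integrableP.
  have mf2 : measurable_fun `[0, b]%classic (EFin \o f).
    exact/measurable_EFinP/measurable_fun_itv_obnd_cbndP.
  split => //; rewrite -integral_itv_obnd_cbnd//.
  exact: measurableT_comp.
have ig : mu.-integrable `]0, b] (EFin \o (fun x => 1 + vnorm (psi x) ^+ 2)).
  rewrite (_ : _ \o _ = (EFin \o (fun=> 1)) \+ (EFin \o (fun x => vnorm (psi x) ^+ 2)))//.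
  apply: integrableD => //.
    have c1 : continuous (fun _ : R => 1 : R) by exact: cst_continuous.
    have i1 := continuous_integrable_itv 0 b c1.
    by apply: integrableS i1 => //; exact: subset_itv_oc_cc.
  have i2 : mu.-integrable (@Rplus R) (EFin \o (fun x => vnorm (psi x) ^+ 2)).
    have [_ _ hfin] := hpsi.
    apply/integrableP; split.
      by have := inL2_measurable hpsi; move/measurable_EFinP.
    by under eq_integral do rewrite /= ger0_norm ?sqr_ge0//.
  by apply: (integrableS _ _ _ i2) => //; exact: measurable_itv.
apply: le_integrable ig.
- exact: measurable_itv.
- exact/measurable_EFinP.
- move=> x _ /=; rewrite lee_fin.
  rewrite [leRHS]ger0_norm ?addr_ge0 ?sqr_ge0//.
  have := hf x; have := sqr_ge0 (vnorm (psi x) - 1); nra.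
Qed.

Lemma inL2_Re_integrable psi i (b : R) : inL2 psi ->
  mu.-integrable `[0, b] (EFin \o (fun x => complex.Re (psi x i 0))).
Proof.
move=> h; apply: (inL2_integrable _ h); first by have [] := h.
move=> x; apply: le_trans (normRe_le_cabs _) _; rewrite vnormE.
case: i => -[|[|//]] hi.
  by rewrite (_ : Ordinal hi = 0) ?cabs_le_pnorml//; exact/val_inj.
by rewrite (_ : Ordinal hi = 1) ?cabs_le_pnormr//; exact/val_inj.
Qed.

Lemma inL2_Im_integrable psi i (b : R) : inL2 psi ->
  mu.-integrable `[0, b] (EFin \o (fun x => complex.Im (psi x i 0))).
Proof.
move=> h; apply: (inL2_integrable _ h); first by have [] := h.
move=> x; apply: le_trans (normIm_le_cabs _) _; rewrite vnormE.
case: i => -[|[|//]] hi.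
  by rewrite (_ : Ordinal hi = 0) ?cabs_le_pnorml//; exact/val_inj.
by rewrite (_ : Ordinal hi = 1) ?cabs_le_pnormr//; exact/val_inj.
Qed.

(** The half-line has infinite measure, so a function that stays away from
    zero near infinity is not square-integrable. *)
Lemma inL2_no_lower_bound psi (b s : R) : inL2 psi ->
  (forall x, b <= x -> s <= vnorm (psi x) ^+ 2) -> s <= 0.
Proof.
move=> h hs; rewrite leNgt; apply/negP => s0.
have [_ _] := h; apply/negP; rewrite -leNgt.
pose a := Num.max b 1.
have sub : `[a, +oo[%classic `<=` @Rplus R.
  move=> x /=; rewrite /Rplus /= !in_itv /= !andbT ge_max => /andP[_].
  exact: lt_le_trans.
have mp := inL2_measurable h.
have m2 : measurable_fun (@Rplus R) (EFin \o (fun x => vnorm (psi x) ^+ 2)).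
  exact/measurable_EFinP.
have le1 : (\int[mu]_(x in `[a, +oo[) (vnorm (psi x) ^+ 2)%:E <=
    \int[mu]_(x in @Rplus R) (vnorm (psi x) ^+ 2)%:E)%E.
  apply: ge0_subset_integral => //.
    exact: measurable_itv.
  by move=> x _; rewrite lee_fin sqr_ge0.
apply: le_trans le1.
apply: (@le_trans _ _ (\int[mu]_(x in `[a, +oo[) cst s%:E x)%E).
  rewrite integral_cst//= lebesgue_measure_itv/= ltry.
  by rewrite addye// gt0_muley// lte_fin.
apply: ge0_le_integral => //.
- by move=> x _; rewrite lee_fin ltW.
- by apply: measurable_funS m2 => //; exact: measurable_itv.
- move=> x /=; rewrite in_itv /= andbT ge_max => /andP[bx _].
  by rewrite lee_fin hs.
Qed.

End SquareIntegrable.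

Section Regularity.
Variable R : realType.
Local Notation mu := (@lebesgue_measure R).
Implicit Types (psi g h : R -> 'cV[R[i]]_2).

Lemma H1_Re psi g i (x : R) : H1 psi g -> 0 <= x ->
  complex.Re (psi x i 0) = complex.Re (psi 0 i 0) +
    \int[mu]_(t in `[0, x]) complex.Re (g t i 0).
Proof. by move=> [_ _ h] /h ->; rewrite !mxE cReD. Qed.

Lemma H1_Im psi g i (x : R) : H1 psi g -> 0 <= x ->
  complex.Im (psi x i 0) = complex.Im (psi 0 i 0) +
    \int[mu]_(t in `[0, x]) complex.Im (g t i 0).
Proof. by move=> [_ _ h] /h ->; rewrite !mxE cImD. Qed.

Lemma H1_ccontinuous psi g i : H1 psi g ->
  ccontinuous (fun x => psi (Num.max x 0) i 0).
Proof.
move=> h; have [_ hg _] := h; split.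
  apply: (continuous_primitive (f := fun x => complex.Re (psi x i 0))
    (g := fun x => complex.Re (g x i 0))) => x x0.
    exact: inL2_Re_integrable.
  exact: H1_Re.
apply: (continuous_primitive (f := fun x => complex.Im (psi x i 0))
  (g := fun x => complex.Im (g x i 0))) => x x0.
  exact: inL2_Im_integrable.
exact: H1_Im.
Qed.

(** The values of [p] at negative arguments only serve to make the derivative
    at [0] two-sided. *)
Lemma H1_cder psi g i (G : R -> R[i]) : H1 psi g -> ccontinuous G ->
  {ae mu, forall x, Rplus x -> g x i 0 = G x} ->
  exists p : R -> R[i], forall x, 0 <= x -> p x = psi x i 0 /\ cder p x (G x).
Proof.
move=> h [GR GI] hae; have [_ hg _] := h.
have [P [P1 P2]] := @derivable_primitive R (fun x => complex.Re (psi x i 0))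
  (fun x => complex.Re (g x i 0)) _ GR
  (fun x _ => inL2_Re_integrable i x hg)
  ltac:(move: hae; apply: filterS; [exact: (ae_filter_ringOfSetsType mu)|
    by move=> x hx /hx ->])
  (fun x => H1_Re i h).
have [Q [Q1 Q2]] := @derivable_primitive R (fun x => complex.Im (psi x i 0))
  (fun x => complex.Im (g x i 0)) _ GI
  (fun x _ => inL2_Im_integrable i x hg)
  ltac:(move: hae; apply: filterS; [exact: (ae_filter_ringOfSetsType mu)|
    by move=> x hx /hx ->])
  (fun x => H1_Im i h).
exists (fun x => P x +i* Q x) => x x0; split.
  by rewrite P1// Q1//; case: (psi x i 0).
by split; [exact: P2|exact: Q2].
Qed.

(** Solved for the derivatives, the equation says that the weak derivative of
    [psi] agrees a.e. with an expression in [psi] and [h], which is continuous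
    because functions in [H1] are; so [psi] is a classical solution. *)
Lemma dirac_regular (m c alpha : R) (z : R[i]) psi f h : c != 0 ->
  D0 m c alpha psi f -> eqL2 (fun x => f x - z *: psi x) h ->
  (forall i, ccontinuous (fun x => h (Num.max x 0) i 0)) ->
  exists p1 p2 : R -> R[i], forall x, 0 <= x ->
    [/\ p1 x = psi x 0 0, p2 x = psi x 1 0 &
    dirac_ode ((z + (m * c ^+ 2)%:C) / c%:C) ((z - (m * c ^+ 2)%:C) / c%:C)
      (fun y => h y 1 0 / c%:C) (fun y => - (h y 0 0 / c%:C)) p1 p2 x].
Proof.
move=> c0 [g [hH _ hf]] hae ch.
have c0' : c%:C != 0 by rewrite (inj_eq (@complexI R) c 0).
set A := _ / c%:C; set B := _ / c%:C.
have cpsi i := H1_ccontinuous i hH.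
have [] := @H1_cder psi g 0
  (fun x => A * psi (Num.max x 0) 1 0 + h (Num.max x 0) 1 0 * c%:C^-1) hH.
- by apply: ccontinuousD; apply: ccontinuousM => //; exact: ccontinuous_cst.
- move: hae; apply: filterS; first exact: (ae_filter_ringOfSetsType mu).
  move=> x hx x0; have := hx x0; rewrite (hf x x0) => /matrixP/(_ 1 0).
  have -> : Num.max x 0 = x.
    by move: x0; rewrite /Rplus /= in_itv /= andbT => /ltW x0; exact/max_idPl.
  by rewrite !mxE /= => <-; rewrite /A; field.
move=> p1 hp1.
have [] := @H1_cder psi g 1
  (fun x => - (B * psi (Num.max x 0) 0 0) + - (h (Num.max x 0) 0 0 * c%:C^-1)) hH.
- by apply: ccontinuousD; apply: ccontinuousN; apply: ccontinuousM => //;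
    exact: ccontinuous_cst.
- move: hae; apply: filterS; first exact: (ae_filter_ringOfSetsType mu).
  move=> x hx x0; have := hx x0; rewrite (hf x x0) => /matrixP/(_ 0 0).
  have -> : Num.max x 0 = x.
    by move: x0; rewrite /Rplus /= in_itv /= andbT => /ltW x0; exact/max_idPl.
  by rewrite !mxE /= => <-; rewrite /B; field.
move=> p2 hp2.
exists p1, p2 => x x0; have [-> d1] := hp1 x x0; have [-> d2] := hp2 x x0.
have mx : Num.max x 0 = x by exact/max_idPl.
split => //; split.
  by apply: (cder_eq d1); rewrite mx (hp2 x x0).1.
by apply: (cder_eq d2); rewrite mx (hp1 x x0).1.
Qed.

End Regularity.

Section Tail.
Variable R : realType.
Implicit Types (psi : R -> 'cV[R[i]]_2).

(** The Wronskian is constant where the source vanishes, so a nonzero value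
    would keep [|psi|] away from zero near infinity.  The domination by [|psi|]
    holds in particular if [e] is bounded. *)
Lemma wronskian_tail0 A B (h1 h2 p1 p2 e1 e2 : R -> R[i]) psi (b C : R) :
  0 <= b -> inL2 psi ->
  (forall x, 0 <= x -> p1 x = psi x 0 0 /\ p2 x = psi x 1 0) ->
  (forall x, 0 <= x -> dirac_ode A B h1 h2 p1 p2 x) ->
  (forall x, b <= x -> h1 x = 0 /\ h2 x = 0) ->
  (forall x, 0 <= x -> dirac_ode A B (fun=> 0) (fun=> 0) e1 e2 x) ->
  (forall x, b <= x ->
     cabs (wronskian p1 p2 e1 e2 x) <= C * pnorm (p1 x) (p2 x)) ->
  forall x, b <= x -> wronskian p1 p2 e1 e2 x = 0.
Proof.
move=> b0 hL hpp hp hh he hC x bx.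
have cst0 y : b <= y -> wronskian p1 p2 e1 e2 y = wronskian p1 p2 e1 e2 b.
  move=> hy; apply: cder_constant => // t /andP[bt _].
  have t0 : 0 <= t by exact: le_trans bt.
  apply: (cder_eq (cder_wronskian (hp t t0) (he t t0))).
  by have [-> ->] := hh t bt; ring.
rewrite cst0//; apply/cabs0_eq/eqP; rewrite eq_le cabs_ge0 andbT.
set w := cabs _; rewrite leNgt; apply/negP => w0.
have hw y : b <= y -> w <= C * vnorm (psi y).
  move=> hy; have y0 : 0 <= y by exact: le_trans hy.
  by have := hC y hy; rewrite cst0// vnormE; have [-> ->] := hpp y y0.
have C0 : 0 < C.
  have := lt_le_trans w0 (hw b (lexx _)).
  by move=> h; rewrite ltNge; apply/negP => C0; move: h;
    rewrite ltNge mulr_le0_ge0// /vnorm sqrtr_ge0.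
have : (w / C) ^+ 2 <= 0.
  apply: (inL2_no_lower_bound (b := b) hL) => y hy.
  rewrite ler_sqr ?nnegrE ?divr_ge0 ?(ltW w0) ?(ltW C0) ?sqrtr_ge0//.
  by rewrite ler_pdivrMr// mulrC hw.
by rewrite leNgt exprn_gt0// divr_gt0.
Qed.

End Tail.

(** * Operator norm and potential *)

Section OperatorNorm.
Variable R : realType.
Implicit Types (A B : 'M[R[i]]_2) (v : 'cV[R[i]]_2).

Lemma mulmx_col2 A v i : (A *m v) i 0 = A i 0 * v 0 0 + A i 1 * v 1 0.
Proof.
rewrite mxE big_ord_recl big_ord1.
by rewrite (_ : lift ord0 ord0 = 1)//; exact/val_inj.
Qed.

Lemma vnorm_ge0 v : 0 <= vnorm v.
Proof. exact: sqrtr_ge0. Qed.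

Lemma vnormZ k v : vnorm (k *: v) = cabs k * vnorm v.
Proof. by rewrite !vnormE !mxE pnormM. Qed.

Lemma vnormD v w : vnorm (v + w) <= vnorm v + vnorm w.
Proof. by rewrite !vnormE !mxE pnormD. Qed.

(** A norm that is visibly continuous in the entries and dominates [opnorm];
    it gives the boundedness and the continuity of [opnorm]. *)
Definition entrynorm A : R :=
  cabs (A 0 0) + cabs (A 0 1) + cabs (A 1 0) + cabs (A 1 1).

Lemma vnorm_mulmx_entrynorm A v : vnorm (A *m v) <= entrynorm A * vnorm v.
Proof.
have h1 := cabs_le_pnorml (v 0 0) (v 1 0).
have h2 := cabs_le_pnormr (v 0 0) (v 1 0).
have row i : cabs ((A *m v) i 0) <= (cabs (A i 0) + cabs (A i 1)) * vnorm v.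
  rewrite mulmx_col2 vnormE mulrDl; apply: le_trans (cabsD _ _) _.
  by rewrite !cabsM lerD// ler_wpM2l// cabs_ge0.
have sum (a b : R[i]) : pnorm a b <= cabs a + cabs b.
  have h0 : 0 <= cabs a + cabs b by rewrite addr_ge0 ?cabs_ge0.
  rewrite /pnorm -[leRHS]ger0_norm// -sqrtr_sqr ler_wsqrtr//.
  have := mulr_ge0 (cabs_ge0 a) (cabs_ge0 b); nra.
rewrite [leLHS]vnormE; apply: le_trans (sum _ _) _.
have := row 0; have := row 1; rewrite /entrynorm; lra.
Qed.

Lemma exists_unit_vector : exists v : 'cV[R[i]]_2, vnorm v = 1.
Proof.
exists (\col_i (i == 0)%:R); rewrite vnormE !mxE /pnorm eqxx mulr1n.
rewrite (_ : (1 == 0 :> 'I_2) = false)// mulr0n.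
by rewrite cabs0 /cabs Normc.normc1 expr1n expr0n addr0 sqrtr1.
Qed.

Lemma opnorm_has_sup A :
  has_sup [set vnorm (A *m v) | v in [set v : 'cV[R[i]]_2 | vnorm v = 1]].
Proof.
split; first by have [v v1] := exists_unit_vector; exists (vnorm (A *m v)), v.
exists (entrynorm A) => _ [v /= v1 <-].
by apply: le_trans (vnorm_mulmx_entrynorm A v) _; rewrite v1 mulr1.
Qed.

Lemma vnorm_mulmx_opnorm A v : vnorm (A *m v) <= opnorm A * vnorm v.
Proof.
have [v0|v0] := eqVneq (vnorm v) 0.
  have := vnorm_mulmx_entrynorm A v; rewrite v0 !mulr0 => h; exact: h.
have vp : 0 < vnorm v by rewrite lt_def v0 vnorm_ge0.
pose u := (vnorm v)^-1%:C *: v.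
have cv : cabs (vnorm v)^-1%:C = (vnorm v)^-1.
  by rewrite cabs_real ger0_norm// invr_ge0 ltW.
have u1 : vnorm u = 1 by rewrite vnormZ cv mulVf.
have : vnorm (A *m u) <= opnorm A.
  by apply: sup_upper_bound; [exact: opnorm_has_sup|exists u].
by rewrite /u -scalemxAr vnormZ cv mulrC ler_pdivrMr.
Qed.

Lemma opnorm_le A (K : R) : (forall v, vnorm v = 1 -> vnorm (A *m v) <= K) ->
  opnorm A <= K.
Proof.
move=> h; apply: sup_le_ub; first by have [] := opnorm_has_sup A.
by move=> _ [v /= v1 <-]; exact: h.
Qed.

Lemma opnorm_ge0 A : 0 <= opnorm A.
Proof.
have [v v1] := exists_unit_vector.
by have := vnorm_mulmx_opnorm A v; rewrite v1 mulr1; apply: le_trans; exact: vnorm_ge0.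
Qed.

Lemma opnorm0 : opnorm (0 : 'M[R[i]]_2) = 0.
Proof.
apply/eqP; rewrite eq_le opnorm_ge0 andbT; apply: opnorm_le => v _.
by rewrite mul0mx vnormE !mxE /pnorm cabs0 expr0n addr0 sqrtr0.
Qed.

Lemma opnorm_lip A B : opnorm A <= opnorm B + entrynorm (A - B).
Proof.
apply: opnorm_le => v v1.
have -> : A *m v = B *m v + (A - B) *m v by rewrite -mulmxDl addrC subrK.
apply: le_trans (vnormD _ _) _; apply: lerD.
  by have := vnorm_mulmx_opnorm B v; rewrite v1 mulr1.
by have := vnorm_mulmx_entrynorm (A - B) v; rewrite v1 mulr1.
Qed.

Lemma continuous_cabs (f : R -> R[i]) : ccontinuous f ->
  continuous (fun x => cabs (f x)).
Proof.
move=> cf x.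
rewrite (_ : (fun y => _) = (fun y => Num.sqrt (cabs (f y) ^+ 2))); last first.
  by apply/funext => y; rewrite sqrtr_sqr ger0_norm// cabs_ge0.
apply: (continuous_comp (continuous_cabs_sqr cf (x := x))).
exact: sqrt_continuous.
Qed.

Lemma continuous_opnorm (V : R -> 'M[R[i]]_2) :
  (forall i j, ccontinuous (fun x => V x i j)) ->
  continuous (fun x => opnorm (V x)).
Proof.
move=> cV x.
have centry i j : cabs ((V y - V x) i j) @[y --> x] --> (0 : R).
  have c1 : ccontinuous (fun y => (V y - V x) i j).
    rewrite (_ : (fun y => _) = (fun y => V y i j - V x i j)); last first.
      by apply/funext => y; rewrite !mxE.
    by apply: ccontinuousD => //; exact: ccontinuous_cst.
  by have := continuous_cabs c1 (x := x); rewrite /continuous_at subrr mxE cabs0.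
have cE : entrynorm (V y - V x) @[y --> x] --> (0 : R).
  rewrite -[X in _ --> X](addr0 (0 : R)) -[X in _ --> X + _](addr0 (0 : R)).
  rewrite -[X in _ --> X + _ + _](addr0 (0 : R)).
  by apply: cvgD; [apply: cvgD; [apply: cvgD|]|]; exact: centry.
have entryC A B : entrynorm (A - B) = entrynorm (B - A).
  by rewrite /entrynorm -[A - B]opprB !mxE !cabsN.
apply/cvgrPdist_le => e e0.
move/cvgrPdist_le/(_ e e0): cE; apply: filterS => y.
rewrite sub0r normrN => h.
have {}h := le_trans (ler_norm _) h.
have h1 := opnorm_lip (V x) (V y); have h2 := opnorm_lip (V y) (V x).
rewrite entryC in h1; move: h1 h2 h.
move: (opnorm (V x)) (opnorm (V y)) (entrynorm (V y - V x)) => a b d h1 h2 h.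
by rewrite ler_norml; apply/andP; split; lra.
Qed.

End OperatorNorm.

Section Potential.
Variable R : realType.
Local Notation mu := (@lebesgue_measure R).
Variable V : R -> 'M[R[i]]_2.
Hypothesis hV : is_potential V.

Lemma potential_ccontinuous i j :
  ccontinuous (fun x => V (Num.max x 0) i j).
Proof.
have c (f : R -> R) : smooth_halfline f -> continuous (fun x : R => f (Num.max x 0)).
  move=> [F [F0 hF]].
  rewrite (_ : (fun x => _) = (fun x : R => F 0%N (Num.max x 0))).
    exact: (continuous_diffquot (d := F 1%N) (hF 0%N)).
  by apply/funext => x; rewrite F0// le_max lexx orbT.
by have [hR hI _] := hV; split; [exact: (c _ (hR i j))|exact: (c _ (hI i j))].
Qed.

(** [opnorm V] enters the estimates only through a primitive of it, whose total
    increment is [norm1 V]. *)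
Lemma potential_primitive : exists N : R -> R,
  (forall x : R, 0 <= x -> is_derive x (1 : R) N (opnorm (V x))) /\
  (forall b, 0 <= b -> (forall x, b <= x -> V x = 0) -> N b - N 0 = norm1 V).
Proof.
pose G (x : R) := opnorm (V (Num.max x 0)).
have cG : continuous G by apply: continuous_opnorm; exact: potential_ccontinuous.
have iG x : 0 <= x -> mu.-integrable `[0, x] (EFin \o G).
  by move=> _; exact: continuous_integrable_itv.
pose f x := \int[mu]_(t in `[0, x]) G t.
have f0 : f 0 = 0 by rewrite /f set_itv1 Rintegral_set1.
have [||N [N1 N2]] := @derivable_primitive R f G G cG iG.
- by apply: aeW => x _.
- by move=> x _; rewrite f0 add0r.
have GV x : 0 <= x -> G x = opnorm (V x) by move=> x0; rewrite /G (max_idPl x0).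
exists N; split => [x x0|b b0 Vb]; first by rewrite -GV//; exact: N2.
rewrite !N1// f0 subr0 /f.
have -> : norm1 V = \int[mu]_(x in `[0, +oo[) G x.
  by apply: eq_Rintegral => x; rewrite inE /= in_itv /= andbT => x0; rewrite GV.
rewrite /Rintegral (integral_halfline_support b0 cG)//.
  by move=> x _; exact: opnorm_ge0.
by move=> x bx; rewrite GV ?Vb ?opnorm0// ltW// (le_lt_trans b0).
Qed.

End Potential.

(** * The spectrum of the free operator *)

Section SpectrumOfFreeOperator.
Variable R : realType.
Variables (m c alpha : R) (z : R[i]).
Hypothesis c0 : 0 < c.

Let A : R[i] := (z + (m * c ^+ 2)%:C) / c%:C.
Let B : R[i] := (z - (m * c ^+ 2)%:C) / c%:C.

(** Where the source vanishes, the only square-integrable solution is zero;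
    evaluated at [1], the end of the support of the source used below. *)
Definition l2_tail_trivial : Prop :=
  forall (psi : R -> 'cV[R[i]]_2) (p1 p2 h1 h2 : R -> R[i]),
    inL2 psi ->
    (forall x, 0 <= x -> p1 x = psi x 0 0 /\ p2 x = psi x 1 0) ->
    (forall x, 0 <= x -> dirac_ode A B h1 h2 p1 p2 x) ->
    (forall x, 1 <= x -> h1 x = 0 /\ h2 x = 0) ->
    p1 1 = 0 /\ p2 1 = 0.

Definition hat (x : R) : R := Num.max (1 - x) 0.

Lemma continuous_hat : continuous hat.
Proof.
move=> x; apply: (@continuous_max R R^o (fun y => 1 - y) (fun=> 0) x).
  by apply: continuousB; [exact: cst_continuous|exact: cvg_id].
exact: cst_continuous.
Qed.

Lemma inL2_hat (u1 u2 : R -> R[i]) : ccontinuous u1 -> ccontinuous u2 ->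
  inL2 (fun x => \col_i ((hat x)%:C * (if i == 0 then u1 x else u2 x)^*)).
Proof.
move=> cu1 cu2.
have ch i : ccontinuous
    (fun x => (hat x)%:C * (if i == 0 :> 'I_2 then u1 x else u2 x)^*).
  apply: ccontinuousM; first exact/ccontinuous_real/continuous_hat.
  by apply: ccontinuous_conj; case: (i == 0).
split.
- move=> i; apply: measurable_funTS; apply: continuous_measurable_fun => x.
  by under eq_fun do rewrite mxE; exact: (ch i).1.
- move=> i; apply: measurable_funTS; apply: continuous_measurable_fun => x.
  by under eq_fun do rewrite mxE; exact: (ch i).2.
pose H (x : R) := cabs ((hat x)%:C * (u1 x)^*) ^+ 2 +
  cabs ((hat x)%:C * (u2 x)^*) ^+ 2.
have HE x : vnorm (\col_i ((hat x)%:C * (if i == 0 :> 'I_2 then u1 x else u2 x)^*)) ^+ 2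
    = H x.
  by rewrite vnormE !mxE pnorm_sqr.
have cH : continuous H.
  move=> x; exact: (continuousD (continuous_cabs_sqr (ch 0) (x := x))
    (continuous_cabs_sqr (ch 1) (x := x))).
under eq_integral do rewrite HE.
rewrite integral_itv_obnd_cbnd; last first.
  apply/measurable_EFinP; apply: measurable_funTS.
  exact: continuous_measurable_fun.
rewrite (integral_halfline_support (b := 1) ler01 cH).
- have /integrableP[_] := continuous_integrable_itv 0 1 cH.
  apply: le_lt_trans; rewrite le_eqVlt; apply/orP; left; apply/eqP.
  apply: eq_integral => x _ /=; rewrite ger0_norm//.
  by rewrite /H addr_ge0 ?sqr_ge0.
- by move=> x _; rewrite /H addr_ge0 ?sqr_ge0.
- move=> x x1; rewrite /H /hat (max_idPr _); last by rewrite subr_le0 ltW.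
  by rewrite !mul0r cabs0 expr0n addr0.
Qed.

(** If a source [hat * conj u], with [u] the solution satisfying the boundary
    condition, were in the range, the Wronskian of the preimage with [u]
    would vanish at [0] and at [1], although its derivative
    [hat * |u| ^ 2 / c] is positive in between. *)
Lemma not_surjective (u1 u2 : R -> R[i]) :
  (forall x, dirac_ode A B (fun=> 0) (fun=> 0) u1 u2 x) ->
  u1 0 = (sin alpha)%:C -> u2 0 = (cos alpha)%:C ->
  (forall x, 0 < pnorm (u1 x) (u2 x)) -> l2_tail_trivial ->
  spectrum (D0 m c alpha) z.
Proof.
move=> hu u10 u20 upos tail [surj _].
have c1 : c%:C != 0 by rewrite (inj_eq (@complexI R) c 0) gt_eqF.
have cu1 : ccontinuous u1 by apply: cder_ccontinuous => x; exact: (hu x).1.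
have cu2 : ccontinuous u2 by apply: cder_ccontinuous => x; exact: (hu x).2.
have [psi [f [hD hf]]] := surj _ (inL2_hat cu1 cu2).
set h := (fun x => \col_i _) in hf.
have ch i : ccontinuous (fun x => h (Num.max x 0) i 0).
  have cm : continuous (fun x : R => Num.max x 0).
    move=> x; apply: (@continuous_max R R^o id (fun=> 0) x).
      exact: cvg_id.
    exact: cst_continuous.
  have cc (k : R -> R[i]) : ccontinuous k -> ccontinuous (fun x => k (Num.max x 0)).
    move=> [k1 k2]; split => x.
      exact: (continuous_comp (cm x) (k1 _)).
    exact: (continuous_comp (cm x) (k2 _)).
  apply: (cc (fun x => h x i 0)).
  apply: (@ccontinuous_eq _ (fun x => (hat x)%:C * (if i == 0 then u1 x else u2 x)^*)).
    by move=> x; rewrite !mxE.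
  apply: ccontinuousM; first exact/ccontinuous_real/continuous_hat.
  by apply: ccontinuous_conj; case: (i == 0).
have [p1 [p2 hp]] := dirac_regular (lt0r_neq0 c0) hD hf ch.
have hLpsi : inL2 psi by have [g [[]]] := hD.
have [p11 p21] : p1 1 = 0 /\ p2 1 = 0.
  apply: (tail psi p1 p2 _ _ hLpsi) => x x0.
  - by have [-> ->] := hp x x0.
  - by have [_ _ hx] := hp x x0; exact: hx.
  - rewrite /h !mxE /hat (max_idPr _); last by rewrite subr_le0.
    by rewrite !mul0r oppr0.
pose W := wronskian p1 p2 u1 u2.
pose dW (x : R) : R := hat x / c * pnorm (u1 x) (u2 x) ^+ 2.
have hW (x : R) : 0 <= x <= 1 -> is_derive x (1 : R) (fun y => complex.Re (W y)) (dW x).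
  move=> /andP[x0 _]; have [_ _ hx] := hp x x0.
  have [+ _] := cder_wronskian hx (hu x).
  rewrite /h !mxE /= -/W => hd; apply: (is_derive_eq hd).
  transitivity (complex.Re ((dW x)%:C)) => //; congr complex.Re.
  rewrite /dW pnorm_sqr rmorphM rmorphD /= -!conj_mul_cabs rmorphM fmorphV /=.
  by field.
have [||t t01 ht] := @MVT R (fun y => complex.Re (W y)) dW 0 1 ltr01.
- by move=> x; rewrite in_itv /= => /andP[x0 x1]; apply: hW; rewrite !ltW.
- exact: (is_derive_within_continuous hW).
have W1 : W 1 = 0 by rewrite /W /wronskian p11 p21 !mul0r subr0.
have W0 : W 0 = 0.
  have [e1 e2 _] := hp 0 (lexx _); have [g [_ + _]] := hD.
  by rewrite /W /wronskian e1 e2 u10 u20 => hb; rewrite -hb; ring.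
move: ht; rewrite W1 W0 subrr subr0 mulr1 => /esym/eqP; rewrite gt_eqF//.
move: t01; rewrite in_itv /= => /andP[t0 t1].
rewrite /dW mulr_gt0 ?exprn_gt0// divr_gt0// /hat lt_max subr_gt0.
by rewrite t1.
Qed.

(** The points of the spectrum other than its edges: the plane waves of real
    momentum [k] and [-k] are bounded. *)
Lemma tail_trivial_oscillating (k : R) (zt : R[i]) : zt != 0 ->
  A = k%:C * zt -> B = k%:C / zt -> l2_tail_trivial.
Proof.
move=> zt0 EA EB psi p1 p2 h1 h2 hL hpp hp hh.
have hw (k' zt' : R[i]) : zt' != 0 -> complex.Im k' = 0 ->
    A = k' * zt' -> B = k' / zt' ->
    wronskian p1 p2 (jost1 k' zt') (jost2 k') 1 = 0.
  move=> zt'0 Ik EA' EB'.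
  apply: (wronskian_tail0 (b := 1) (C := Num.sqrt (cabs zt' ^+ 2 + 1))
    ler01 hL hpp hp hh) => //.
    by move=> x _; rewrite EA' EB'; exact: jost_dirac.
  move=> x _; apply: le_trans (cross_le _ _ _ _) _.
  by rewrite mulrC pnorm_jost Ik mul0r oppr0 expR0 mul1r.
have ztN : - zt != 0 by rewrite oppr_eq0.
have w1 := hw k%:C zt zt0 erefl EA EB.
have w2 : wronskian p1 p2 (jost1 (- k%:C) (- zt)) (jost2 (- k%:C)) 1 = 0.
  by apply: hw => //=; rewrite ?oppr0// ?invrN mulrNN.
have E0 (k' : R[i]) : planewave k' 1 != 0.
  by apply/eqP => e; have := planewaveK k' 1; rewrite e mul0r => /esym/eqP; rewrite oner_eq0.
have i0 : 'i != 0 :> R[i] by rewrite eq_complex /= oner_eq0 andbF.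
have v1 : p1 1 * 'i - p2 1 * zt = 0.
  apply: (mulIf (E0 k%:C)); rewrite mul0r -[RHS]w1 /wronskian /jost1 /jost2; ring.
have v2 : p1 1 * 'i + p2 1 * zt = 0.
  apply: (mulIf (E0 (- k%:C))); rewrite mul0r -[RHS]w2 /wronskian /jost1 /jost2; ring.
split.
  apply: (mulIf i0); rewrite mul0r.
  transitivity (2^-1 * ((p1 1 * 'i - p2 1 * zt) + (p1 1 * 'i + p2 1 * zt))).
    by field.
  by rewrite v1 v2 addr0 mulr0.
apply: (mulIf zt0); rewrite mul0r.
transitivity (2^-1 * ((p1 1 * 'i + p2 1 * zt) - (p1 1 * 'i - p2 1 * zt))).
  by field.
by rewrite v1 v2 subr0 mulr0.
Qed.

(** The edges of the spectrum: one of the constants [(0, 1)] and [(1, 0)]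
    is a bounded solution, and once the corresponding component is known to
    vanish, the growing solution can be used as well. *)
Lemma tail_trivial_edgeA : A = 0 -> l2_tail_trivial.
Proof.
move=> A0 psi p1 p2 h1 h2 hL hpp hp hh.
have q1 x : 1 <= x -> p1 x = 0.
  move=> x1; rewrite -(wronskian_tail0 (e1 := fun=> 0) (e2 := fun=> 1)
    (b := 1) (C := 1) ler01 hL hpp hp hh _ _ x1).
  - by rewrite /wronskian mulr1 mulr0 subr0.
  - move=> y _; apply: dirac_ode_hom; rewrite ?A0 ?mul0r ?mulr0 ?oppr0;
      exact: cder_cst.
  - move=> y _; rewrite /wronskian mulr1 mulr0 subr0 mul1r.
    exact: cabs_le_pnorml.
split; first exact: q1.
apply/eqP; rewrite -oppr_eq0; apply/eqP.
rewrite -(wronskian_tail0 (e1 := fun=> 1) (e2 := fun y => 0 + - B * y%:C)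
    (b := 1) (C := 1) ler01 hL hpp hp hh _ _ (lexx 1)).
- by rewrite /wronskian q1// mul0r mulr1 sub0r.
- move=> y _; apply: dirac_ode_hom; rewrite ?A0 ?mul0r ?mulr1.
    exact: cder_cst.
  exact: cder_affine.
- move=> y y1; rewrite /wronskian q1// mul0r mulr1 sub0r mul1r cabsN.
  exact: cabs_le_pnormr.
Qed.

Lemma tail_trivial_edgeB : B = 0 -> l2_tail_trivial.
Proof.
move=> B0 psi p1 p2 h1 h2 hL hpp hp hh.
have q2 x : 1 <= x -> p2 x = 0.
  move=> x1; apply/eqP; rewrite -oppr_eq0; apply/eqP.
  rewrite -(wronskian_tail0 (e1 := fun=> 1) (e2 := fun=> 0)
    (b := 1) (C := 1) ler01 hL hpp hp hh _ _ x1).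
  - by rewrite /wronskian mulr1 mulr0 sub0r.
  - move=> y _; apply: dirac_ode_hom; rewrite ?B0 ?mul0r ?mulr0 ?oppr0;
      exact: cder_cst.
  - move=> y _; rewrite /wronskian mulr1 mulr0 sub0r mul1r cabsN.
    exact: cabs_le_pnormr.
split; last exact: q2.
rewrite -(wronskian_tail0 (e1 := fun y => 0 + A * y%:C) (e2 := fun=> 1)
    (b := 1) (C := 1) ler01 hL hpp hp hh _ _ (lexx 1)).
- by rewrite /wronskian q2// mul0r mulr1 subr0.
- move=> y _; apply: dirac_ode_hom; rewrite ?B0 ?mul0r ?mulr1 ?oppr0.
    exact: cder_affine.
  exact: cder_cst.
- move=> y y1; rewrite /wronskian q2// mul0r mulr1 subr0 mul1r.
  exact: cabs_le_pnorml.
Qed.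

Lemma cos_sin_neq0 : cos alpha = 0 -> sin alpha = 0 -> False.
Proof.
move=> h1 h2; have := cos2Dsin2 alpha; rewrite h1 h2 expr0n addr0 => /esym/eqP.
by rewrite oner_eq0.
Qed.

(** With [z^2 - (m c^2)^2 = s^2], the number [A * B] is the square of the real
    momentum [s / c]; the solutions oscillate if it is nonzero, and are affine
    functions if [A] or [B] vanishes. *)
Lemma spectrum_real (s : R) :
  z ^+ 2 - (m * c ^+ 2)%:C ^+ 2 = s%:C ^+ 2 -> spectrum (D0 m c alpha) z.
Proof.
move=> hs.
have c1 : c%:C != 0 by rewrite (inj_eq (@complexI R) c 0) gt_eqF.
have AB : A * B = (s / c)%:C ^+ 2.
  rewrite rmorphM fmorphV /= expr_div_n -hs /A /B; field; exact: c1.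
have [A0|A0] := eqVneq A 0.
  apply: (not_surjective (u1 := fun=> (sin alpha)%:C)
    (u2 := fun x => (cos alpha)%:C + - (B * (sin alpha)%:C) * x%:C)).
  - move=> x; apply: dirac_ode_hom; first by rewrite A0 mul0r; exact: cder_cst.
    exact: cder_affine.
  - by [].
  - by rewrite mulr0 addr0.
  - move=> x; apply: pnorm_gt0 => /complexI h; rewrite h mulr0 oppr0 mul0r addr0.
    by move=> /complexI /cos_sin_neq0; exact.
  - exact: tail_trivial_edgeA.
have [B0|B0] := eqVneq B 0.
  apply: (not_surjective (u1 := fun x => (sin alpha)%:C + A * (cos alpha)%:C * x%:C)
    (u2 := fun=> (cos alpha)%:C)).
  - move=> x; apply: dirac_ode_hom; first exact: cder_affine.
    by rewrite B0 mul0r oppr0; exact: cder_cst.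
  - by rewrite mulr0 addr0.
  - by [].
  - move=> x; apply: pnorm_gt0 => + /complexI h; rewrite h mulr0 mul0r addr0.
    by move=> /complexI; exact: cos_sin_neq0.
  - exact: tail_trivial_edgeB.
set k := (s / c)%:C in AB.
have k0 : k != 0.
  by apply: contraNneq (mulf_neq0 A0 B0) => k0; rewrite AB k0 expr0n.
pose zt := A / k.
have zt0 : zt != 0 by rewrite mulf_neq0// invr_eq0.
have EA : A = k * zt by rewrite /zt mulrC divfK.
have EB : B = k / zt.
  have solve (a b d : R[i]) : a != 0 -> d != 0 -> a * b = d ^+ 2 -> b = d / (a / d).
    by move=> a0 d0 ab; apply: (mulfI a0); rewrite ab; field; rewrite d0 a0.
  exact: solve A0 k0 AB.
apply: (not_surjective (u1 := ode_sol1 k zt (sin alpha)%:C (cos alpha)%:C)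
  (u2 := ode_sol2 k zt (sin alpha)%:C (cos alpha)%:C)).
- by move=> x; rewrite EA EB; exact: ode_sol_dirac.
- by rewrite /ode_sol1 ccos0 csin0 mulr1 mulr0 addr0.
- by rewrite /ode_sol2 ccos0 csin0 mulr1 mulr0 subr0.
- move=> x; apply: pnorm_gt0 => u0 v0.
  (* [ccos^2 + csin^2 = 1] is the determinant of the map from the initial
     value to the value at [x], so this map is inverted explicitly. *)
  have d1 := ccos2_csin2 k x.
  apply: cos_sin_neq0; apply: complexI.
    transitivity (zt^-1 * csin k x * ode_sol1 k zt (sin alpha)%:C (cos alpha)%:C x
      + ccos k x * ode_sol2 k zt (sin alpha)%:C (cos alpha)%:C x).
      rewrite -[LHS]mul1r -d1 /ode_sol1 /ode_sol2; field; exact: zt0.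
    by rewrite u0 v0 !mulr0 addr0.
  transitivity (ccos k x * ode_sol1 k zt (sin alpha)%:C (cos alpha)%:C x
      - zt * csin k x * ode_sol2 k zt (sin alpha)%:C (cos alpha)%:C x).
    rewrite -[LHS]mul1r -d1 /ode_sol1 /ode_sol2; field; exact: zt0.
  by rewrite u0 v0 !mulr0 subr0.
- exact: (tail_trivial_oscillating zt0 EA EB).
Qed.

End SpectrumOfFreeOperator.

(** * The spectral parameters [kappa] and [zeta] *)

Section SpectralParameter.
Variable R : realType.
Implicit Types w z : R[i].

Lemma ReV w : complex.Re w^-1 = complex.Re w / cabs w ^+ 2.
Proof. by rewrite cabs_sqr; case: w. Qed.

Lemma ImV w : complex.Im w^-1 = - (complex.Im w / cabs w ^+ 2).
Proof. by rewrite cabs_sqr; case: w. Qed.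

Lemma sqrt_up_sqr w : sqrt_up w ^+ 2 = w.
Proof. by rewrite /sqrt_up; case: ifP => _; rewrite ?sqrrN sqr_sqrtc. Qed.

Lemma sqrt_up_Im_gt0 w : complex.Im (sqrtc w) != 0 -> 0 < complex.Im (sqrt_up w).
Proof.
rewrite /sqrt_up => w0; case: ifP => // /negbT; rewrite -leNgt => w1.
by rewrite cImN oppr_gt0 lt_neqAle w0.
Qed.

Variables (m c : R) (z : R[i]).
Hypotheses (c0 : 0 < c) (m0 : 0 < m).
Let mc := (m * c ^+ 2)%:C.
Let k0 := sqrt_up (z ^+ 2 - mc ^+ 2).
Hypothesis Ik0 : 0 < complex.Im k0.

Let cC0 : c%:C != 0.
Proof. by rewrite (inj_eq (@complexI R) c 0) gt_eqF. Qed.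

Let mcR0 : 0 < m * c ^+ 2.
Proof. by rewrite mulr_gt0// exprn_gt0. Qed.

Let k0_neq0 : k0 != 0.
Proof. by apply: contraTneq Ik0 => ->; rewrite ltxx. Qed.

Let k0_sqr : k0 * k0 = (z - mc) * (z + mc).
Proof. by rewrite -expr2 sqrt_up_sqr; ring. Qed.

Let zp_neq0 : z + mc != 0.
Proof.
by apply: contraNneq (mulf_neq0 k0_neq0 k0_neq0) => h; rewrite k0_sqr h mulr0.
Qed.

Let zm_neq0 : z - mc != 0.
Proof.
by apply: contraNneq (mulf_neq0 k0_neq0 k0_neq0) => h; rewrite k0_sqr h mul0r.
Qed.

Lemma kappa_mul : c%:C * kappa m c z = k0.
Proof. by rewrite /kappa mulrC divfK. Qed.

Lemma zetaE : zeta m c z = (z + mc) / k0.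
Proof. by rewrite /zeta kappa_mul. Qed.

Lemma zeta_neq0 : zeta m c z != 0.
Proof. by rewrite zetaE mulf_neq0// invr_eq0. Qed.

Lemma zetaV : (zeta m c z)^-1 = (z - mc) / k0.
Proof.
apply: (mulfI zeta_neq0); rewrite divff ?zeta_neq0// zetaE.
have -> : (z + mc) / k0 * ((z - mc) / k0) = (z - mc) * (z + mc) / (k0 * k0).
  by rewrite invfM; ring.
by rewrite -k0_sqr divff// mulf_neq0.
Qed.

Lemma kappa_zeta : (z + mc) / c%:C = kappa m c z * zeta m c z.
Proof.
rewrite zetaE /kappa -/mc -/k0.
by rewrite [RHS]mulrC mulrA divfK.
Qed.

Lemma kappa_zetaV : (z - mc) / c%:C = kappa m c z / zeta m c z.
Proof.
rewrite zetaV /kappa -/mc -/k0.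
by rewrite [RHS]mulrC mulrA divfK.
Qed.

Lemma Im_kappa_gt0 : 0 < complex.Im (kappa m c z).
Proof.
rewrite /kappa -/mc -/k0 -fmorphV mulrC cImM (cReC c^-1) (cImC c^-1) mul0r addr0.
by rewrite mulr_gt0// invr_gt0.
Qed.

Lemma energy_of_zeta :
  z = mc * ((zeta m c z ^+ 2 + 1) / (zeta m c z ^+ 2 - 1)).
Proof.
have z2 : zeta m c z ^+ 2 = (z + mc) / (z - mc).
  rewrite zetaE expr_div_n [k0 ^+ 2]expr2 k0_sqr.
  by rewrite expr2 -mulf_div divff// mulr1.
have mc0 : mc != 0 by rewrite (inj_eq (@complexI R) _ 0) gt_eqF.
have cayley (x y : R[i]) : y != 0 -> x - y != 0 ->
    x = y * (((x + y) / (x - y) + 1) / ((x + y) / (x - y) - 1)).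
  move=> y0 d0.
  have -> : (x + y) / (x - y) + 1 = 2 * x / (x - y) by field.
  have -> : (x + y) / (x - y) - 1 = 2 * y / (x - y) by field.
  by field; rewrite y0 d0.
by rewrite z2; exact: cayley.
Qed.

Lemma zeta_subV : zeta m c z - (zeta m c z)^-1 = (2 * (m * c ^+ 2))%:C / k0.
Proof.
rewrite zetaV zetaE -mulrBl rmorphM /= -/mc; congr (_ / _).
by rewrite rmorph_nat; ring.
Qed.

(** The imaginary parts of [w] and [- w^-1] have the same sign, so the sign can
    be read off from [zeta - zeta^-1], a positive multiple of [k0^-1]. *)
Lemma Im_zeta_lt0 : complex.Im (zeta m c z) < 0.
Proof.
have := congr1 (@complex.Im R) zeta_subV.
rewrite cImD cImN ImV.
set y := complex.Im (zeta m c z); set r := cabs (zeta m c z) ^+ 2.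
rewrite cImM (cReC (2 * (m * c ^+ 2))) (cImC (2 * (m * c ^+ 2))) mul0r addr0 ImV.
have r0 : 0 < r by rewrite exprn_gt0// cabs_gt0// zeta_neq0.
have q0 : 0 < 2 * (m * c ^+ 2) * (complex.Im k0 / cabs k0 ^+ 2).
  apply: mulr_gt0; first by apply: mulr_gt0.
  by apply: divr_gt0 => //; apply: exprn_gt0; exact: cabs_gt0.
move=> e; rewrite ltNge; apply/negP => y0.
have : 0 <= y / r by rewrite divr_ge0// ltW.
lra.
Qed.

(** [kappa] is a positive multiple of [(zeta - zeta^-1)^-1], and the real and
    imaginary parts of [zeta - zeta^-1] are [(r - r^-1) cos t] and
    [(r + r^-1) sin t]. *)
Lemma Re_kappa :
  let w := zeta m c z in let r := cabs w in
  complex.Re (kappa m c z) =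
  - ((r - r^-1) / (r + r^-1) * (complex.Re w / complex.Im w)
     * complex.Im (kappa m c z)).
Proof.
move=> w r.
have r0 : 0 < r by rewrite cabs_gt0// zeta_neq0.
have y0 : complex.Im w < 0 := Im_zeta_lt0.
have : complex.Im ((w - w^-1) * kappa m c z) = 0.
  have -> : (w - w^-1) * kappa m c z = (2 * (m * c ^+ 2) / c)%:C.
    rewrite zeta_subV /kappa -/mc -/k0 mulrA divfK// [RHS]rmorphM.
    by rewrite fmorphV.
  by [].
rewrite cImM cReD cImD cReN cImN ReV ImV -/r.
have solve (x y p q : R) : y != 0 ->
    (x - x / r ^+ 2) * q + (y - - (y / r ^+ 2)) * p = 0 ->
    p = - ((r - r^-1) / (r + r^-1) * (x / y) * q).
  move: r0 {y0} => + y0; move: r => s s0.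
  have s1 : s != 0 by rewrite gt_eqF.
  have s2 : s * s + 1 != 0 by rewrite gt_eqF// ltr_wpDl// -expr2 sqr_ge0.
  move=> e; apply: (mulIf (mulf_neq0 y0 s2)).
  have -> : - ((s - s^-1) / (s + s^-1) * (x / y) * q) * (y * (s * s + 1)) =
      - ((s ^+ 2 - 1) * x * q).
    by field; rewrite y0 s1 s2.
  apply/eqP; rewrite -subr_eq0 opprK; apply/eqP.
  transitivity (s ^+ 2 * ((x - x / s ^+ 2) * q + (y - - (y / s ^+ 2)) * p)).
    by field.
  by rewrite e mulr0.
by apply: solve; rewrite lt_eqF.
Qed.

(** The polar angle, taken in [(- pi, 0)] since [zeta] lies in the lower half
    plane. *)
Lemma zeta_polar : let w := zeta m c z in let r := cabs w in
  exists t : R, [/\ - pi < t < 0, w = r%:C * (cos t +i* sin t) &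
    cot t = complex.Re w / complex.Im w].
Proof.
move=> w r.
have r0 : 0 < r by rewrite cabs_gt0// zeta_neq0.
have r1 : r != 0 by rewrite gt_eqF.
have y0 : complex.Im w < 0 := Im_zeta_lt0.
set x := complex.Re w; set y := complex.Im w in y0 *.
have y1 : y != 0 by rewrite lt_eqF.
have rE : r ^+ 2 = x ^+ 2 + y ^+ 2 by exact: cabs_sqr.
pose d := x / r.
have d2 : 1 - d ^+ 2 = (y / r) ^+ 2.
  by rewrite /d !expr_div_n rE; field; rewrite -rE expf_neq0.
have y2 : 0 < (y / r) ^+ 2 by rewrite exprn_even_gt0//= mulf_neq0// invr_eq0.
have d1 : -1 < d < 1 by apply/andP; split; nra.
have d1' : -1 <= d <= 1 by case/andP: d1 => *; rewrite !ltW.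
have ct : cos (- acos d) = x / r by rewrite cosN acosK// in_itv.
have st : sin (- acos d) = y / r.
  rewrite sinN sin_acos// d2 sqrtr_sqr ler0_norm ?opprK//.
  by rewrite mulr_le0_ge0 ?invr_ge0 ?ltW.
exists (- acos d); split.
- case/andP: d1 => a b; rewrite ltrN2 oppr_lt0 acos_gt0 ?acos_ltpi//.
    by rewrite a ltW.
  by rewrite b ltW.
- rewrite ct st; apply: complex_eq.
    by rewrite [RHS]cReM /= mul0r subr0 mulrCA divff// mulr1.
  by rewrite [RHS]cImM /= mul0r addr0 mulrCA divff// mulr1.
- by rewrite /cot ct st invfM invrK mulrACA mulVf// mulr1.
Qed.

End SpectralParameter.

(** * The norm of the Green kernel *)

Section GreenKernelNorm.
Variable R : realType.

Lemma Gplus_Gminus (a b : R) : Gplus a b = Gminus (- a) b.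
Proof.
rewrite /Gplus /Gminus; congr (Num.sqrt (sup _)); 
by apply: eq_imagel => y _; rewrite !mulNr cosN mulrN !mulNr opprK.
Qed.

Lemma Gminus_ge (a b y : R) : 0 <= y ->
  Num.sqrt ((1 + expR (- (2 * y))) - 2 * a * expR (- y) * cos (a * b * y))
    <= Gminus a b.
Proof.
move=> y0; rewrite ler_wsqrtr//; apply: sup_upper_bound; last first.
  by exists y => //=; rewrite in_itv /= y0.
split; first by exists ((1 + expR (- (2 * y))) - 2 * a * expR (- y) * cos (a * b * y)), y;
  rewrite //= in_itv /= y0.
exists (2 + 2 * `|a|) => _ [s /= + <-]; rewrite in_itv /= andbT => s0.
have e1 : expR (- (2 * s)) <= 1 by rewrite expR_le1 oppr_le0 mulr_ge0.
have e2 : expR (- s) <= 1 by rewrite expR_le1 oppr_le0.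
have : - (2 * a * expR (- s) * cos (a * b * s)) <= 2 * `|a|.
  apply: le_trans (ler_norm _) _; rewrite normrN !normrM ger0_norm//.
  rewrite -[leRHS]mulr1 -!mulrA ler_wpM2l// ler_wpM2l ?normr_ge0//.
  rewrite [`|expR _|]ger0_norm ?expR_ge0//.
  by rewrite mulr_ile1 ?expR_ge0 ?normr_ge0 ?cos_max.
lra.
Qed.

Variables (k zt : R[i]).
Hypotheses (zt0 : zt != 0) (Ik : 0 < complex.Im k).
Let r := cabs zt.
Variable b : R.
Let a : R := (r - r^-1) / (r + r^-1).
Hypothesis Rek : complex.Re k = - (a * b * complex.Im k).

Let r0 : 0 < r. Proof. exact: cabs_gt0. Qed.

Let half_ge0 : 0 <= (r + r^-1) / 2.
Proof. by rewrite divr_ge0// addr_ge0 ?invr_ge0// ltW. Qed.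

Let cosE (x : R) : cos (2 * complex.Re k * x) = cos (a * b * (2 * complex.Im k * x)).
Proof. by rewrite Rek -cosN; congr cos; ring. Qed.

Let pnorm_jost_planewave x : pnorm (jost1 k zt x) (jost2 k x) =
  cabs (planewave k x) * Num.sqrt (r ^+ 2 + 1).
Proof. by rewrite pnorm_jost cabs_planewave. Qed.

Let decay_ge0 x : 0 <= x -> 0 <= 2 * complex.Im k * x.
Proof. by move=> x0; rewrite !mulr_ge0// ltW. Qed.

(** The bracket in [Gminus] is evaluated at [2 Im k x]. Here [r = |zt|] is the
    modulus of the Wronskian of the two solutions. *)
Lemma green_kernel_dirichlet x : 0 <= x ->
  pnorm (ode_sol1 k zt 0 1 x) (ode_sol2 k zt 0 1 x) *
    pnorm (jost1 k zt x) (jost2 k x)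
  <= r * ((r + r^-1) / 2 * Gminus a b).
Proof.
move=> x0; rewrite pnorm_jost_planewave mulrA [_ * cabs _]mulrC -pnormM.
rewrite /ode_sol1 /ode_sol2 !mul0r mul1r add0r subr0 mul1r.
set E := planewave k x.
have -> : E * (zt * csin k x) = zt * (csin k x * E) by ring.
have -> : E * ccos k x = ccos k x * E by ring.
have h := Gminus_ge a b (decay_ge0 x0).
apply: le_trans (ler_wpM2l _ (ler_wpM2l _ h)); last 2 first.
- exact: ltW.
- exact: half_ge0.
rewrite le_eqVlt; apply/orP; left; apply/eqP.
set X := (X in _ = _ * (_ * Num.sqrt X)).
rewrite [RHS]mulrA -[r * (_ / 2)]ger0_norm; last first.
  by rewrite mulr_ge0// ltW.
rewrite -sqrtr_sqr -[RHS]sqrtrM ?sqr_ge0// /pnorm -sqrtrM ?addr_ge0 ?sqr_ge0//.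
congr Num.sqrt.
rewrite cabsM exprMn cabs_csin_planewave cabs_ccos_planewave cosE -/r /X /a.
have r1 : r != 0 by rewrite gt_eqF.
have r2 : r ^+ 2 + 1 != 0 by rewrite gt_eqF// ltr_wpDl// sqr_ge0.
by field; rewrite r1 -expr2 r2.
Qed.

(** The same computation with the roles of the two components exchanged, which
    replaces [a] by [- a]; the Wronskian now has modulus one. *)
Lemma green_kernel_neumann x : 0 <= x ->
  pnorm (ode_sol1 k zt 1 0 x) (ode_sol2 k zt 1 0 x) *
    pnorm (jost1 k zt x) (jost2 k x)
  <= (r + r^-1) / 2 * Gplus a b.
Proof.
move=> x0; rewrite pnorm_jost_planewave mulrA [_ * cabs _]mulrC -pnormM.
rewrite /ode_sol1 /ode_sol2 !mul0r mul1r addr0 sub0r mul1r.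
set E := planewave k x.
have -> : E * - (zt^-1 * csin k x) = - (zt^-1 * (csin k x * E)) by ring.
have -> : E * ccos k x = ccos k x * E by ring.
have h := Gminus_ge (- a) b (decay_ge0 x0).
rewrite Gplus_Gminus; apply: le_trans (ler_wpM2l _ h); last first.
  exact: half_ge0.
rewrite le_eqVlt; apply/orP; left; apply/eqP.
set X := (X in _ = _ * Num.sqrt X).
rewrite -[_ / 2]ger0_norm; last first.
  exact: half_ge0.
rewrite -sqrtr_sqr -[RHS]sqrtrM ?sqr_ge0// /pnorm -sqrtrM ?addr_ge0 ?sqr_ge0//.
congr Num.sqrt.
rewrite cabsN (cabsM zt^-1) exprMn cabsV cabs_csin_planewave cabs_ccos_planewave cosE -/r.
rewrite /X !mulNr cosN /a.
have r1 : r != 0 by rewrite gt_eqF.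
have r2 : r ^+ 2 + 1 != 0 by rewrite gt_eqF// ltr_wpDl// sqr_ge0.
by field; rewrite r1 -expr2 r2.
Qed.

End GreenKernelNorm.

(** * The bound on eigenvalues *)

Section EigenvalueBound.
Variable R : realType.

(** At a point where [|psi|] is maximal, the Green kernel bound can be divided
    by that maximum. *)
Lemma eigenvalue_bound (m c alpha : R) (V : R -> 'M[R[i]]_2) (z k zt : R[i])
    (S : R) : 0 < c -> is_potential V -> zt != 0 -> 0 < complex.Im k ->
  (z + (m * c ^+ 2)%:C) / c%:C = k * zt ->
  (z - (m * c ^+ 2)%:C) / c%:C = k / zt ->
  eigenvalue_of (add_potential (D0 m c alpha) V) z ->
  let sa := (sin alpha)%:C in let ca := (cos alpha)%:C in
  let w := cabs (sa * 'i - ca * zt) in 0 < w ->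
  (forall x, 0 <= x -> pnorm (ode_sol1 k zt sa ca x) (ode_sol2 k zt sa ca x) *
    pnorm (jost1 k zt x) (jost2 k x) <= w * S) ->
  1 <= S * (norm1 V / c).
Proof.
move=> c0 hV zt0 Ik EA EB [psi [f [[f0 [hD hf]] hne hz]]] sa ca w w0 hS.
have c1 : c%:C != 0 by rewrite (inj_eq (@complexI R) c 0) gt_eqF.
have [g [hH hbc _]] := hD.
have hL : inL2 psi by case: hH.
pose h x := - (V x *m psi x).
have hh : eqL2 (fun x => f0 x - z *: psi x) h.
  move: hz; apply: filterS.
    exact: (ae_filter_ringOfSetsType (@lebesgue_measure R)).
  move=> x hx x0; rewrite -(hx x0) (hf x x0) /h.
  by rewrite opprD addrA subrr sub0r.
have ch i : ccontinuous (fun x => h (Num.max x 0) i 0).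
  apply: (@ccontinuous_eq _ (fun x : R => - (V (Num.max x 0) i 0 * psi (Num.max x 0) 0 0
      + V (Num.max x 0) i 1 * psi (Num.max x 0) 1 0))).
    by move=> x; rewrite /h mxE mulmx_col2.
  by apply: ccontinuousN; apply: ccontinuousD; apply: ccontinuousM;
    (exact: potential_ccontinuous || exact: (H1_ccontinuous _ hH)).
have [p1 [p2 hp]] := dirac_regular (lt0r_neq0 c0) hD hh ch.
rewrite EA EB in hp.
have hpE x : 0 <= x -> pnorm (p1 x) (p2 x) = vnorm (psi x).
  by move=> x0; have [-> -> _] := hp x x0; rewrite vnormE.
have [x0 x0gt psi0] : exists2 x, 0 < x & psi x <> 0.
  apply: contrapT => hno; apply: hne; apply: aeW => x.
  rewrite /Rplus /= in_itv /= andbT => x0; apply: contrapT => hx.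
  by apply: hno; exists x.
have [_ _ [M hM]] := hV.
(* [b] is beyond the support of [V], and [[0, b]] contains a point where
   [psi] is nonzero, so that the maximum below is positive. *)
pose b := Num.max x0 (M + 1).
have b0 : 0 <= b by rewrite /b le_max ltW.
have Vb x : b <= x -> V x = 0.
  move=> bx; apply: hM; first exact: le_trans bx.
  by apply: lt_le_trans bx; rewrite /b lt_max ltrDl ltr01 orbT.
have hode (y : R) : 0 <= y -> dirac_ode (k * zt) (k / zt)
    (fun y => h y 1 0 / c%:C) (fun y => - (h y 0 0 / c%:C)) p1 p2 y.
  by move=> y0; have [] := hp y y0.
have [xm hxm hmax] : exists2 x, 0 <= x <= b & forall y, 0 <= y <= b ->
    pnorm (p1 y) (p2 y) <= pnorm (p1 x) (p2 x).
  by apply: pnorm_attains_max b0 _ => x /andP[x1 _]; exact: hode.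
set Mx := pnorm (p1 xm) (p2 xm) in hmax.
have Mx0 : 0 < Mx.
  apply: (@lt_le_trans _ _ (pnorm (p1 x0) (p2 x0))).
    apply: pnorm_gt0 => e1 e2; apply: psi0.
    have [q1 q2 _] := hp x0 (ltW x0gt).
    apply/matrixP => i j; rewrite (ord1 j) mxE; case: i => -[|[|//]] hi.
      by rewrite (_ : Ordinal hi = 0) -?q1 ?e1//; exact/val_inj.
    by rewrite (_ : Ordinal hi = 1) -?q2 ?e2//; exact/val_inj.
  by apply: hmax; rewrite ltW//= /b le_max lexx.
have [N [hN hNb]] := potential_primitive hV.
have jost_le y t : y <= t -> pnorm (jost1 k zt t) (jost2 k t) <=
    pnorm (jost1 k zt y) (jost2 k y).
  move=> yt; rewrite !pnorm_jost ler_wpM2r ?sqrtr_ge0// ler_expR lerN2.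
  by rewrite ler_wpM2l// ltW.
have Qb : wronskian p1 p2 (jost1 k zt) (jost2 k) b = 0.
  apply: (wronskian_tail0 (b := b) (C := pnorm (jost1 k zt 0) (jost2 k 0)) b0 hL
    _ hode _ (fun x _ => jost_dirac k zt0 x)) => //.
  - by move=> x x0'; have [-> -> _] := hp x x0'.
  - by move=> x bx; rewrite /h Vb// mul0mx oppr0 !mxE mul0r oppr0.
  - move=> x bx; apply: le_trans (cross_le _ _ _ _) _; rewrite mulrC.
    by rewrite ler_wpM2r ?pnorm_ge0// jost_le// (le_trans b0).
have P0 : wronskian p1 p2 (ode_sol1 k zt sa ca) (ode_sol2 k zt sa ca) 0 = 0.
  have [e1 e2 _] := hp 0 (lexx _).
  rewrite /wronskian /ode_sol1 /ode_sol2 ccos0 csin0 !mulr0 !mulr1 addr0 subr0.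
  by rewrite e1 e2 -hbc /sa /ca; ring.
have := @green_estimate R (k * zt) (k / zt) _ _ p1 p2
  (ode_sol1 k zt sa ca) (ode_sol2 k zt sa ca) (jost1 k zt) (jost2 k)
  (fun y => Mx / c * N y) (fun y => Mx / c * opnorm (V y)) b (w * S) xm
  hode
  (fun y _ => ode_sol_dirac k zt0 sa ca y) (fun y _ => jost_dirac k zt0 y)
  _ _ _ P0 Qb hxm.
rewrite -/Mx -mulrBr hNb//.
have -> : cabs (wronskian (ode_sol1 k zt sa ca) (ode_sol2 k zt sa ca)
    (jost1 k zt) (jost2 k) 0) = w.
  rewrite /wronskian /ode_sol1 /ode_sol2 ccos0 csin0 /jost1 /jost2 planewave0.
  by rewrite !mulr0 !mulr1 addr0 subr0.
move=> hgreen.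
have : w * Mx <= w * S * (Mx / c * norm1 V).
  apply: hgreen.
  - move=> y y0; apply: (is_derive_eq
      (is_deriveM (is_derive_cst (Mx / c) y 1) (hN y y0))).
    by rewrite /GRing.scale /= mulr0 addr0.
  - move=> y /andP[y0 yb].
    rewrite pnormC pnormNl.
    have -> : pnorm (h y 0 0 / c%:C) (h y 1 0 / c%:C) = vnorm (V y *m psi y) / c.
      rewrite ![_ / c%:C]mulrC pnormM cabsV cabs_real gtr0_norm// -vnormE /h.
      by rewrite mulrC -scaleN1r vnormZ cabsN [cabs 1]Normc.normc1 mul1r.
    rewrite mulrAC ler_wpM2r ?invr_ge0 ?(ltW c0)//.
    apply: le_trans (vnorm_mulmx_opnorm _ _) _.
    rewrite mulrC ler_wpM2r ?opnorm_ge0// -hpE//.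
    by apply: hmax; rewrite y0.
  - move=> y t y0 yt; apply: le_trans (hS y y0).
    by rewrite ler_wpM2l ?pnorm_ge0// jost_le.
have -> : w * S * (Mx / c * norm1 V) = (w * Mx) * (S * (norm1 V / c)) by ring.
by rewrite -[leLHS]mulr1 ler_pM2l// mulr_gt0.
Qed.

End EigenvalueBound.

Lemma inv_le_of_one_le (R : realType) (P n c : R) : 0 < c -> 0 <= P ->
  1 <= P / 2 * (n / c) -> P^-1 <= 1 / (2 * c) * n.
Proof.
move=> c0 P0 h.
have P1 : 0 < P.
  rewrite lt_def P0 andbT; apply/eqP => e.
  by move: h; rewrite e !mul0r ler10.
rewrite -[leLHS]mul1r ler_pdivrMr//; apply: le_trans h _.
rewrite le_eqVlt; apply/orP; left; apply/eqP; field.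
by rewrite gt_eqF.
Qed.

Theorem theorem2p2 (R : realType) (c m alpha : R) (V : R -> 'M[R[i]]_2)
    (hc : 0 < c) (hm : 0 < m) (halpha : alpha = 0 \/ alpha = pi / 2)
    (hV : is_potential V) (hv : norm1 V / c < 1 / Num.sqrt 2) (z : R[i]) :
  ~ spectrum (D0 m c alpha) z ->
  eigenvalue_of (add_potential (D0 m c alpha) V) z ->
  let w := zeta m c z in
  let r := cabs w in
  let a := (r - r^-1) / (r + r^-1) in
  z = (m * c ^+ 2)%:C * ((w ^+ 2 + 1) / (w ^+ 2 - 1)) /\
  exists t : R,
    [/\ - pi < t < 0,
        w = r%:C * (cos t +i* sin t),
        alpha = 0 ->
          ((r + r^-1) * Gminus a (cot t))^-1
            <= 1 / (2 * c) * norm1 V &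
        alpha = pi / 2 ->
          ((r + r^-1) * Gplus a (cot t))^-1
            <= 1 / (2 * c) * norm1 V].
Proof.
move=> hspec heig.
(* Were the root real, [z] would be in the spectrum. *)
have Ik0 : 0 < complex.Im (sqrt_up (z ^+ 2 - (m * c ^+ 2)%:C ^+ 2)).
  apply: sqrt_up_Im_gt0; apply/eqP => h; apply: hspec.
  apply: (@spectrum_real R m c alpha z hc
    (complex.Re (sqrtc (z ^+ 2 - (m * c ^+ 2)%:C ^+ 2)))).
  rewrite -[LHS]sqr_sqrtc; congr (_ ^+ 2).
  by apply: complex_eq => //=; rewrite h.
move=> w r a; split; first exact: energy_of_zeta.
have [t [ht wt ct]] := zeta_polar hc hm Ik0.
have w0 : w != 0 by exact: zeta_neq0.
have r0 : 0 < r by exact: cabs_gt0.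
have rr0 : 0 <= r + r^-1 by rewrite addr_ge0 ?invr_ge0// ltW.
have Ik := Im_kappa_gt0 hc Ik0.
have hRe : complex.Re (kappa m c z) = - (a * cot t * complex.Im (kappa m c z)).
  by rewrite ct; exact: Re_kappa.
have hb := eigenvalue_bound hc hV w0 Ik (kappa_zeta hc Ik0) (kappa_zetaV hc Ik0) heig.
exists t; split => // ea.
- apply: inv_le_of_one_le => //; first by rewrite mulr_ge0// sqrtr_ge0.
  rewrite [_ * _ / 2]mulrAC; apply: hb; rewrite ea sin0 cos0 mul0r mul1r sub0r cabsN.
    exact: r0.
  by move=> x x0; exact: green_kernel_dirichlet.
- apply: inv_le_of_one_le => //; first by rewrite mulr_ge0// sqrtr_ge0.
  have c1 : cabs 'i = 1 :> R by rewrite cabsE /= expr0n add0r expr1n sqrtr1.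
  rewrite [_ * _ / 2]mulrAC; apply: hb.
    rewrite ea sin_pihalf cos_pihalf mul0r mul1r subr0 c1.
    exact: ltr01.
  rewrite ea sin_pihalf cos_pihalf mul0r mul1r subr0 c1.
  by move=> x x0; rewrite mul1r; exact: green_kernel_neumann.
Qed.
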